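(* Let $(X,|\cdot|_X)$ and $(Y,|\cdot|_Y)$ be real Banach spaces and let $f:X\to Y$ be a local $C^1$-diffeomorphism. For $y\in Y$ let $F_y:X\to\mathbb{R}$, $F_y(x)=\frac12|f(x)-y|_Y^2$. Let $h:[0,+\infty)\to[0,+\infty)$ be a continuous nondecreasing function such that $\int_0^\infty\frac{1}{1+h(\rho)}\,d\rho=+\infty$. Suppose that for each $y\in Y$ there is no sequence $\{x_n\}$ in $X$ such that $$\lim_{n\to\infty}F_y(x_n)=c \text{ for some } c>0\quad\text{and}\quad \lim_{n\to\infty}\lambda_{F_y}(x_n)(1+h(|x_n|_X))=0.$$ Then $f$ is one-to-one.
   Context: A map $f:X\to Y$ is a local $C^1$-diffeomorphism if it is $C^1$ and $df(x)$ is a linear isomorphism of $X$ onto $Y$ for every $x\in X$. For a locally Lipschitz functional $F:X\to\mathbb{R}$ on a real Banach space $X$ with dual $X^*$, the generalized directional derivative is $F^0(x;v)=\limsup_{z\to 0,\ t\downarrow 0}\frac1t\left(F(x+z+tv)-F(x+z)\right)$, the Clarke generalized gradient is $\partial F(x)=\{w^*\in X^*: \langle w^*,v\rangle\le F^0(x;v)\ \forall v\in X\}$ (a nonempty convex weak*-compact set), and $\lambda_F(x)=\min_{w^*\in\partial F(x)}|w^*|_{X^*}$. *)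

(* Defs.v *)
From mathcomp Require Import all_boot all_order all_algebra.
From mathcomp Require Import all_classical all_reals all_analysis.

Set Implicit Arguments.
Unset Strict Implicit.
Unset Printing Implicit Defensive.

Import Order.TTheory GRing.Theory Num.Theory.
Import numFieldNormedType.Exports.

Local Open Scope classical_set_scope.
Local Open Scope ring_scope.

(* The supremum is taken in R, so it is the operator norm only for bounded
   (i.e. continuous) linear maps; it is applied to no other maps below. *)
Definition opnorm (R : realType) (V W : normedModType R) (L : V -> W) : R :=
  sup [set `|L v| | v in [set v : V | `|v| <= 1]].

Definition C1 (R : realType) (X Y : normedModType R) (f : X -> Y) : Prop :=
  (forall x, differentiable f x) /\
  (forall x, opnorm (fun v => 'd f z v - 'd f x v) @[z --> x] --> (0 : R)).

(* ['d f x] is by construction linear, and continuous as soon as f is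
   differentiable at x. *)
Definition local_C1_diffeo (R : realType) (X Y : normedModType R)
    (f : X -> Y) : Prop :=
  C1 f /\ forall x, bijective ('d f x : X -> Y).

(* F^0(x; v), with z ranging over a neighbourhood of 0 and t over a right
   neighbourhood of 0, jointly; it is finite when F is Lipschitz near x. *)
Definition clarke_dir (R : realType) (X : normedModType R) (F : X -> R)
    (x v : X) : \bar R :=
  limf_esup
    (fun zt : X * R =>
       (zt.2^-1 * (F (x + zt.1 + zt.2 *: v) - F (x + zt.1)))%:E)
    (filter_prod (nbhs (0 : X)) (0 : R)^'+).

Definition clarke_gradient (R : realType) (X : normedModType R) (F : X -> R)
    (x : X) : set {linear X -> R^o} :=
  [set w : {linear X -> R^o} |
    continuous w /\ forall v : X, ((w v : R)%:E <= clarke_dir F x v)%E].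

(* The infimum is a minimum whenever F is locally Lipschitz, since the norm is
   weak*-lower semicontinuous and the gradient is nonempty and weak*-compact. *)
Definition clarke_lambda (R : realType) (X : normedModType R) (F : X -> R)
    (x : X) : R :=
  inf [set opnorm w | w in clarke_gradient F x].

Lemma clarke_lambda_min (R : realType) (X : normedModType R) (F : X -> R)
    (x : X) (w : {linear X -> R^o}) :
    clarke_gradient F x w ->
    (forall w', clarke_gradient F x w' -> opnorm w <= opnorm w') ->
  clarke_lambda F x = opnorm w.
Proof.
move=> Fw minw; apply/eqP; rewrite eq_le; apply/andP; split.
  apply: ge_inf; last by exists w.
  by exists (opnorm w) => _ [w' Fw' <-]; exact: minw.
apply: lb_le_inf; first by exists (opnorm w), w.
by move=> _ [w' Fw' <-]; exact: minw.
Qed.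

Definition half_sqdist (R : realType) (X Y : normedModType R) (f : X -> Y)
    (y : Y) (x : X) : R :=
  2^-1 * `|f x - y| ^+ 2.

(* Main.v *)
(** If [f a = f b = y] with [a <> b], then [F = |f - y|^2 / 2] vanishes at [a]
    and [b] but is bounded below on a small sphere about [a], because ['d f a]
    has a bounded inverse: the mountain pass level [c] of [F] between [a] and
    [b] is positive.  By Hahn-Banach, wherever the Clarke gradient stays away
    from 0 there is a direction of decrease, and such directions at a given
    point form a convex set, so along a path they glue to a continuous vector
    field that lowers the maximum of [F].  Let [phi] be a primitive of
    [1 / (1 + h)].  Among pairs (path, r) such that the path lies in the ball
    of radius [r] and its level is at most [B - m phi(r)], ordered by
    [|q - p| <= r' - r], the radius is bounded, since [phi] is unbounded and
    levels are at least [c]; a maximal pair exists by completeness, and it can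
    be improved unless [lambda_F(x) (1 + h |x|)] is small somewhere near level
    [c]. *)

From HB Require Import structures.
Require Import Defs.
From mathcomp Require Import all_boot all_order all_algebra.
From mathcomp Require Import all_classical all_reals all_analysis.
From mathcomp Require Import ring lra.
Import Order.TTheory GRing.Theory Num.Theory.
Import numFieldNormedType.Exports.
Local Open Scope classical_set_scope.
Local Open Scope ring_scope.

Set Implicit Arguments.
Unset Strict Implicit.
Unset Printing Implicit Defensive.

(** * Hahn-Banach for a convex function above [- m |.|] *)

(** Only the inequality for [a > 0] has to be checked for the infima below; applied to [a^-1] it
    gives equality, and [q 0 = 0] covers [a = 0]. *)
Definition sublinear (R : realType) (V : lmodType R) (q : V -> R) : Prop :=
  (forall u v, q (u + v) <= q u + q v) /\
  (forall a v, 0 < a -> q (a *: v) <= a * q v).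

Lemma sublinear0 (R : realType) (V : lmodType R) (q : V -> R) :
  sublinear q -> q 0 = 0.
Proof.
move=> [qD qZ]; have := qD 0 0; have := qZ (2^-1) 0.
by rewrite addr0 scaler0 invr_gt0 ltr0n => /(_ isT); lra.
Qed.

Lemma sublinearZ (R : realType) (V : lmodType R) (q : V -> R) (a : R) (v : V) :
  sublinear q -> 0 <= a -> q (a *: v) = a * q v.
Proof.
move=> sq; have [qD qZ] := sq; rewrite le_eqVlt => /predU1P[<-|a0].
  by rewrite scale0r mul0r sublinear0.
apply/eqP; rewrite eq_le qZ//=.
have := qZ a^-1 (a *: v); rewrite invr_gt0 => /(_ a0).
by rewrite scalerA mulVf ?gt_eqF// scale1r ler_pdivlMl.
Qed.

Lemma sublinear_geN (R : realType) (V : lmodType R) (q : V -> R) (v : V) :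
  sublinear q -> - q (- v) <= q v.
Proof.
move=> sq; have [qD _] := sq; have := qD v (- v).
by rewrite subrr (sublinear0 sq); lra.
Qed.

(** For fixed [u], the infimum over [t >= 0] of [q (x + t *: u) - t * q u] is sublinear in [x] and
    at most [q x]. By minimality it is [q], and [t = 1] then gives superadditivity, hence
    linearity. *)
Lemma minimal_sublinear_linear (R : realType) (V : lmodType R) (q : V -> R) :
  sublinear q ->
  (forall q', sublinear q' -> (forall v, q' v <= q v) ->
     forall v, q v <= q' v) ->
  exists w : {linear V -> R^o}, forall v, w v = q v.
Proof.
move=> sq qmin; have [qD qZ] := sq.
have q_superadd u v : q v + q u <= q (v + u).
  pose S v := [set q (v + t *: u) - t * q u | t in [set t | 0 <= t]].
  have Slb x : lbound (S x) (- q (- x)).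
    move=> _ [t /= t0 <-]; have := qD (x + t *: u) (- x).
    by rewrite addrAC subrr add0r sublinearZ//; lra.
  have hS x : has_inf (S x).
    by split; [exists (q (x + 0 *: u) - 0 * q u), 0 => /=|exists (- q (- x))].
  have iS x t : 0 <= t -> inf (S x) <= q (x + t *: u) - t * q u.
    by move=> t0; apply: ge_inf; [case: (hS x)|exists t].
  have := qmin (fun x => inf (S x)) _ _ v.
  have sS : sublinear (fun x => inf (S x)).
    split=> [x y|a x a0].
      rewrite -lerBlDl; apply: lb_le_inf; first by case: (hS y).
      move=> _ [t /= t0 <-]; rewrite lerBlDl -lerBlDr.
      apply: lb_le_inf; first by case: (hS x).
      move=> _ [s /= s0 <-]; rewrite lerBlDr.
      apply: le_trans (iS _ _ (addr_ge0 s0 t0)) _.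
      have := qD (x + s *: u) (y + t *: u).
      by rewrite addrACA -scalerDl mulrDl; lra.
    rewrite -ler_pdivrMl//; apply: lb_le_inf; first by case: (hS x).
    move=> _ [t /= t0 <-]; rewrite ler_pdivrMl//.
    apply: le_trans (iS _ _ (mulr_ge0 (ltW a0) t0)) _.
    by rewrite -scalerA -scalerDr mulrBr mulrA lerD2r qZ.
  move=> /(_ sS) h; have {h}: q v <= inf (S v).
    by apply: h => x; apply: le_trans (iS _ _ (lexx 0)) _;
      rewrite scale0r addr0 mul0r subr0.
  move=> h; have := le_trans h (iS _ _ (ler01)).
  by rewrite scale1r mul1r; lra.
have q_add u v : q (u + v) = q u + q v.
  by apply/eqP; rewrite eq_le qD q_superadd.
have qN u : q (- u) = - q u.
  by have := q_add u (- u); rewrite subrr sublinear0//; lra.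
have qlin : linear (q : V -> R^o).
  move=> a u v; rewrite q_add; congr (_ + _).
  have [a0|a0] := leP 0 a; first exact: sublinearZ.
  rewrite -[a in LHS]opprK scaleNr qN sublinearZ ?oppr_ge0 ?ltW//.
  by rewrite mulNr opprK.
pose w : {linear V -> R^o} :=
  HB.pack (q : V -> R^o) (GRing.isLinear.Build _ _ _ _ _ qlin).
by exists w.
Qed.

(** Zorn's lemma on the sublinear functionals below [p], ordered downwards: the pointwise infimum of
    a chain is finite because every member is at least [- p (- x)] at [x]. A minimal functional is
    linear. *)
Lemma hahn_banach_sublinear (R : realType) (V : lmodType R) (p : V -> R) :
  sublinear p -> exists w : {linear V -> R^o}, forall v, w v <= p v.
Proof.
move=> sp.
pose T := {q : V -> R | sublinear q /\ forall v, q v <= p v}.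
pose ge (s t : T) := `[< forall v, sval t v <= sval s v >].
have [| | |A Atot|[q [sq qp]] qmax] := @Zorn T ge.
- by move=> t; apply/asboolP.
- move=> r s t /asboolP rs /asboolP st; apply/asboolP => v.
  exact: le_trans (st v) (rs v).
- move=> [s Ps] [t Pt] /asboolP st /asboolP ts; apply: eq_exist => /=.
  by apply/funext => v; apply/eqP; rewrite eq_le st ts.
- have [[q0 Aq0]|A0] := pselect (exists q, A q); last first.
    exists (exist _ p (conj sp (fun v => lexx (p v)))) => s As.
    by exfalso; apply: A0; exists s.
  pose S v := [set sval q v | q in A].
  have hS x : has_inf (S x).
    split; first by exists (sval q0 x), q0.
    exists (- p (- x)) => _ [[q [sq qp]] Aq <-] /=.
    by apply: le_trans (sublinear_geN _ sq); rewrite lerN2.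
  have iS x (q : T) : A q -> inf (S x) <= sval q x.
    by move=> Aq; apply: ge_inf; [case: (hS x)|exists q].
  have sS : sublinear (fun x => inf (S x)).
    split=> [x y|a x a0].
      rewrite -lerBlDl; apply: lb_le_inf; first by case: (hS y).
      move=> _ [t At <-]; rewrite lerBlDl -lerBlDr.
      apply: lb_le_inf; first by case: (hS x).
      move=> _ [s As <-]; rewrite lerBlDr.
      have [/asboolP st|/asboolP ts] := Atot s t As At.
        apply: le_trans (iS _ _ At) _.
        apply: le_trans ((svalP t).1.1 x y) _.
        by rewrite lerD2r.
      apply: le_trans (iS _ _ As) _.
      apply: le_trans ((svalP s).1.1 x y) _.
      by rewrite lerD2l.
    rewrite -ler_pdivrMl//; apply: lb_le_inf; first by case: (hS x).
    move=> _ [t At <-]; rewrite ler_pdivrMl//.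
    exact: le_trans (iS _ _ At) ((svalP t).1.2 _ _ a0).
  have Sp v : inf (S v) <= p v by apply: le_trans (iS _ _ Aq0) ((svalP q0).2 v).
  exists (exist _ (fun x => inf (S x)) (conj sS Sp)) => s As.
  by apply/asboolP => v /=; exact: iS.
have [|w wq] := @minimal_sublinear_linear R V q sq; last first.
  by exists w => v; rewrite wq.
move=> q' sq' q'q v.
have q'p u : q' u <= p u := le_trans (q'q u) (qp u).
have := qmax (exist _ q' (conj sq' q'p)).
have -> : ge (exist _ q (conj sq qp)) (exist _ q' (conj sq' q'p)).
  exact/asboolP.
by move=> /(_ isT)[->].
Qed.

(* The sublinear functional [v |-> inf_{t > 0, u} g (t (v + u)) / t + m |u|] is
   dominated both by [g] and by [m |.|]. *)
Lemma convex_sandwich (R : realType) (V : normedModType R) (g : V -> R) (m : R) :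
  (forall a u v, 0 <= a <= 1 ->
     g (a *: u + (1 - a) *: v) <= a * g u + (1 - a) * g v) ->
  g 0 = 0 -> 0 <= m -> (forall v, 0 <= g v + m * `|v|) ->
  exists w : {linear V -> R^o},
    (forall v, w v <= g v) /\ (forall v, `|w v| <= m * `|v|).
Proof.
move=> gconv g0 m0 gm.
pose S v := [set g (t.1 *: (v + t.2)) / t.1 + m * `|t.2| | t in
   [set t : R * V | 0 < t.1]].
have Slb x : lbound (S x) (- (m * `|x|)).
  move=> _ [[t u] /= t0 <-].
  have := gm (t *: (x + u)); rewrite normrZ gtr0_norm// => h.
  have : 0 <= (g (t *: (x + u)) + m * (t * `|x + u|)) / t.
    by rewrite divr_ge0// ltW.
  rewrite mulrDl mulrCA [t * _ / t]mulrAC mulfV ?gt_eqF// mul1r.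
  have := ler_wpM2l m0 (ler_normD x u); rewrite mulrDr; lra.
have hS x : has_inf (S x).
  split; last by exists (- (m * `|x|)).
  by eexists; exists (1, 0) => /=.
have iS x t u : 0 < t -> inf (S x) <= g (t *: (x + u)) / t + m * `|u|.
  by move=> t0; apply: ge_inf; [case: (hS x)|exists (t, u)].
have [|w wS] := @hahn_banach_sublinear R V (fun x => inf (S x)).
  split=> [x y|a x a0].
    rewrite -lerBlDl; apply: lb_le_inf; first by case: (hS y).
    move=> _ [[t u] /= t0 <-]; rewrite lerBlDl -lerBlDr.
    apply: lb_le_inf; first by case: (hS x).
    move=> _ [[s v] /= s0 <-]; rewrite lerBlDr.
    have st0 : 0 < s + t by rewrite addr_gt0.
    (* With this scale, [x + y + (v + u)] is sent to the convex combination of [s *: (x + v)] and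
       [t *: (y + u)] with weights [t / (s + t)] and [s / (s + t)]. *)
    have r0 : 0 < s * t / (s + t) by rewrite divr_gt0// mulr_gt0.
    apply: le_trans (iS _ _ (v + u) r0) _.
    rewrite (addrACA x y) [X in _ <= X]addrACA -mulrDr.
    apply: lerD; last by rewrite ler_wpM2l// ler_normD.
    rewrite ler_pdivrMr//.
    have := gconv (t / (s + t)) (s *: (x + v)) (t *: (y + u)).
    have -> : 1 - t / (s + t) = s / (s + t) by field; rewrite gt_eqF.
    have -> : 0 <= t / (s + t) <= 1.
      by rewrite ltW ?divr_gt0//= ler_pdivrMr// mul1r lerDr ltW.
    rewrite !scalerA => /(_ isT).
    have -> : t / (s + t) * s = s * t / (s + t) by field; rewrite gt_eqF.
    have -> : s / (s + t) * t = s * t / (s + t) by field; rewrite gt_eqF.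
    rewrite -scalerDr => /le_trans; apply; rewrite le_eqVlt; apply/orP; left.
    by apply/eqP; field; rewrite !gt_eqF.
  rewrite -ler_pdivrMl//; apply: lb_le_inf; first by case: (hS x).
  move=> _ [[t u] /= t0 <-]; rewrite ler_pdivrMl//.
  have ta0 : 0 < t / a by rewrite divr_gt0.
  apply: le_trans (iS _ _ (a *: u) ta0) _.
  rewrite -scalerDr scalerA divfK ?gt_eqF// normrZ gtr0_norm//.
  rewrite le_eqVlt; apply/orP; left; apply/eqP; field.
  by rewrite !gt_eqF.
have wm v : w v <= m * `|v|.
  apply: le_trans (wS v) _; apply: le_trans (iS _ _ (- v) ltr01) _.
  by rewrite subrr scaler0 g0 mul0r add0r normrN.
exists w; split=> v.
  apply: le_trans (wS v) _; apply: le_trans (iS _ _ 0 ltr01) _.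
  by rewrite addr0 scale1r divr1 normr0 mulr0 addr0.
by rewrite ler_norml wm andbT; have := wm (- v); rewrite linearN normrN lerNl.
Qed.

(** * From the Clarke gradient to descent directions *)

Lemma differentiable_eps (R : realType) (X Y : normedModType R) (f : X -> Y)
    (x : X) (e : R) : differentiable f x -> 0 < e ->
  exists2 r, 0 < r & forall h, `|h| < r ->
    `|f (x + h) - f x - 'd f x h| <= e * `|h|.
Proof.
move=> /diff_locally/eqaddoP fo e0.
have /nbhs_ballP[r /= r0 rP] := fo e e0.
exists r => // h hr; have := rP h; rewrite -ball_normE /= sub0r normrN.
by move=> /(_ hr); rewrite !fctE /= opprD addrA (addrC h).
Qed.

Lemma sqr_norm_convex (R : realType) (V : normedModType R) (a : R) (u v : V) :
  0 <= a <= 1 ->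
  `|a *: u + (1 - a) *: v| ^+ 2 <= a * `|u| ^+ 2 + (1 - a) * `|v| ^+ 2.
Proof.
move=> /andP[a0 a1].
have h : `|a *: u + (1 - a) *: v| <= a * `|u| + (1 - a) * `|v|.
  apply: le_trans (ler_normD _ _) _.
  by rewrite !normrZ !ger0_norm// subr_ge0.
have h2 : `|a *: u + (1 - a) *: v| ^+ 2 <= (a * `|u| + (1 - a) * `|v|) ^+ 2.
  by rewrite lerXn2r// ?nnegrE// (le_trans _ h).
apply: le_trans h2 _.
have : 0 <= a * (1 - a) * (`|u| - `|v|) ^+ 2.
  by rewrite mulr_ge0 ?sqr_ge0// mulr_ge0// subr_ge0.
by lra.
Qed.

(** Freezing the base point at [z = 0] can only lower the limsup, so difference quotients in [t]
    suffice; replacing [f] by its linearisation in them costs [o(t)]. *)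
Lemma clarke_dir_ge (R : realType) (X Y : normedModType R) (f : X -> Y)
    (y : Y) (x v : X) (a : R) : differentiable f x ->
  (forall t, 0 < t -> t * a <=
     2^-1 * `|f x - y + t *: 'd f x v| ^+ 2 - 2^-1 * `|f x - y| ^+ 2) ->
  (a%:E <= clarke_dir (half_sqdist f y) x v)%E.
Proof.
move=> dfx ha; rewrite /clarke_dir limf_esupE.
apply: le_ereal_inf_tmp => /= _ [A [[P Q] /= [P0 Q0] PQA] <-].
apply/lee_subgt0Pr => e e0.
set U := f x - y; set k := 'd f x v.
(* [M] bounds [|U + t *: k|] for [t <= 1], so a remainder of norm at most [t * (e / M)] costs at
   most [t * e] in half the square; [N] absorbs [|v|]. *)
pose M := `|U| + `|k| + 1.
have M0 : 0 < M by rewrite /M ltr_pwDr// addr_ge0.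
pose N := `|v| + 1.
have N0 : 0 < N by rewrite /N ltr_pwDr.
have eta0 : 0 < e / M / N by rewrite !divr_gt0.
have [r r0 rP] := differentiable_eps dfx eta0.
have [t [t0 t1 tr Qt]] : exists t, [/\ 0 < t, t <= 1, t * `|v| < r & Q t].
  near (0 : R)^'+ => t; exists t; split => //.
  - near: t; exact: nbhs_right_le.
  - rewrite (@le_lt_trans _ _ (t * N))// ?ler_wpM2l ?lerDl//.
    rewrite -ltr_pdivlMr//; near: t; apply: nbhs_right_lt.
    by rewrite divr_gt0.
  - by near: t.
apply: le_ereal_sup_tmp.
exists (t^-1 * (half_sqdist f y (x + 0 + t *: v) - half_sqdist f y (x + 0)))%:E.
  exists (0, t) => //=; apply: PQA; split => //=; exact: nbhs_singleton.
rewrite -EFinB lee_fin addr0 ler_pdivlMl// /half_sqdist.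
have htv : `|t *: v| = t * `|v| by rewrite normrZ gtr0_norm.
have := rP (t *: v); rewrite htv => /(_ tr).
rewrite linearZ/= -/k => hd.
have UtE : f (x + t *: v) - y = (U + t *: k) + (f (x + t *: v) - f x - t *: k).
  by rewrite [RHS]addrC addrACA addNr addr0 /U subrKA.
set W := f (x + t *: v) - y in UtE *.
set rem := _ - _ - _ in UtE hd.
have hrem : `|rem| <= t * (e / M).
  have hv : `|v| / N <= 1 by rewrite ler_pdivrMr// mul1r lerDl.
  have eM : 0 < e / M by rewrite divr_gt0.
  apply: le_trans hd _; rewrite mulrCA ler_wpM2l ?(ltW t0)//.
  by rewrite mulrAC -[leLHS]mulrA ler_piMr ?(ltW eM).
have hW : `|U + t *: k| <= `|W| + t * (e / M).
  have -> : U + t *: k = W - rem by rewrite UtE addrK.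
  by apply: le_trans (ler_normB _ _) _; rewrite lerD2l.
have hUM : `|U + t *: k| <= M.
  apply: le_trans (ler_normD _ _) _; rewrite normrZ gtr0_norm//.
  have : t * `|k| <= `|k| by rewrite -[leRHS]mul1r ler_wpM2r.
  by rewrite /M; lra.
have := ha t t0; rewrite -/U -/k => h1.
have h2 : `|U + t *: k| ^+ 2 <= `|W| ^+ 2 + 2 * M * (t * (e / M)).
  have d0 : 0 <= t * (e / M) by rewrite mulr_ge0 ?divr_ge0// ltW.
  have [h|h] := leP `|U + t *: k| `|W|.
    have : `|U + t *: k| ^+ 2 <= `|W| ^+ 2 by rewrite lerXn2r ?nnegrE.
    by have := mulr_ge0 (ltW M0) d0; lra.
  have h3 : 0 <= `|U + t *: k| - `|W| by lra.
  have h4 : `|U + t *: k| - `|W| <= t * (e / M) by lra.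
  have h5 : `|U + t *: k| + `|W| <= 2 * M by lra.
  have := ler_pM h3 (addr_ge0 (normr_ge0 _) (normr_ge0 _)) h4 h5.
  by rewrite -subr_sqr; lra.
have Me : 2 * M * (t * (e / M)) = 2 * t * e by field; rewrite gt_eqF.
by move: h2; rewrite Me mulrBr; lra.
Unshelve. all: by end_near. Qed.

(** The decrease is asked of the linearisation of [f], for one [t] only, since convexity passes it
    on to smaller [t]. It is strict so as to survive small perturbations; the factor 2 undoes the
    half in [half_sqdist]. *)
Definition descent_direction (R : realType) (X Y : normedModType R) (f : X -> Y)
    (y : Y) (mu : R) (x w : X) : Prop :=
  `|w| <= 1 /\ exists2 t, 0 < t &
    `|f x - y + t *: 'd f x w| ^+ 2 + 2 * mu * t < `|f x - y| ^+ 2.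

Lemma opnorm_le (R : realType) (V W : normedModType R) (L : V -> W) (m : R) :
  0 <= m -> (forall v, `|L v| <= m * `|v|) -> opnorm L <= m.
Proof.
move=> m0 Lm; apply: ge_sup; first by exists `|L 0|, 0 => //=; rewrite normr0.
by move=> _ [v /= v1 <-]; apply: le_trans (Lm v) _; rewrite ler_piMr.
Qed.

Lemma opnorm_ge0 (R : realType) (V W : normedModType R) (L : V -> W) :
  0 <= opnorm L.
Proof.
rewrite /opnorm; set S := [set _ | _ in _].
have [hS|hS] := pselect (has_sup S); last by rewrite sup_out.
apply: le_trans (normr_ge0 (L 0)) (ub_le_sup (proj2 hS) _).
by exists 0 => //=; rewrite normr0.
Qed.

Lemma clarke_lambda_ge0 (R : realType) (X : normedModType R) (F : X -> R)
    (x : X) : 0 <= clarke_lambda F x.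
Proof.
rewrite /clarke_lambda; set S := [set _ | _ in _].
have [->|/set0P S0] := eqVneq S set0; first by rewrite inf0.
by apply: lb_le_inf => // _ [w _ <-]; exact: opnorm_ge0.
Qed.

(** Without such a direction, the convex change [g] of half the squared distance in the linearised
    problem stays above [- mu |v|]. A linear [w] below both [g] and [mu |v|] then lies in the Clarke
    gradient and forces [clarke_lambda] to be at most [mu]. *)
Lemma exists_descent_direction (R : realType) (X Y : normedModType R)
    (f : X -> Y) (y : Y) (mu : R) (x : X) : differentiable f x -> 0 <= mu ->
  mu < clarke_lambda (half_sqdist f y) x ->
  exists w, descent_direction f y mu x w.
Proof.
move=> dfx mu0 hmu; apply: contrapT => nw.
set U := f x - y.
pose g v := 2^-1 * `|U + 'd f x v| ^+ 2 - 2^-1 * `|U| ^+ 2.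
have gm v : 0 <= g v + mu * `|v|.
  rewrite leNgt; apply/negP => gv; apply: nw.
  have v0 : v != 0.
    apply: contraTneq gv => ->.
    by rewrite /g linear0 addr0 subrr add0r normr0 mulr0 ltxx.
  have nv0 : 0 < `|v| by rewrite normr_gt0.
  exists (`|v|^-1 *: v); split.
    by rewrite normrZ normfV normr_id mulVf ?gt_eqF.
  exists `|v| => //; rewrite linearZ scalerA mulfV ?gt_eqF// scale1r -/U.
  by move: gv; rewrite /g; lra.
have [| |w [wg wm]] := @convex_sandwich R X g mu _ _ mu0 gm.
- move=> a u v a01; rewrite /g.
  have -> : U + 'd f x (a *: u + (1 - a) *: v) =
      a *: (U + 'd f x u) + (1 - a) *: (U + 'd f x v).
    rewrite linearD !linearZ/= (scalerDr a U) (scalerDr (1 - a) U).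
    rewrite [RHS]addrACA -scalerDl.
    by rewrite (addrC a) subrK scale1r.
  by have := sqr_norm_convex (U + 'd f x u) (U + 'd f x v) a01; lra.
- by rewrite /g linear0 addr0 subrr.
have gw : clarke_gradient (half_sqdist f y) x w.
  split.
    apply/linear_bounded_continuous/linear_boundedP.
    exists mu; split; first exact: num_real.
    by move=> r mur v; apply: le_trans (wm v) _; rewrite ler_wpM2r// ltW.
  move=> v; apply: clarke_dir_ge => // t t0.
  have <- : w (t *: v) = t * w v by rewrite linearZ.
  have <- : 'd f x (t *: v) = t *: 'd f x v by rewrite linearZ.
  exact: wg.
have : clarke_lambda (half_sqdist f y) x <= mu.
  apply: (@le_trans _ _ (opnorm w)).
    apply: ge_inf; last by exists w.
    by exists 0 => _ [w' _ <-]; exact: opnorm_ge0.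
  exact: opnorm_le.
by rewrite leNgt hmu.
Qed.

(** * Strict differentiability of C1 maps *)

(** The step is applied at the supremum of the points where [P] holds: it carries [P] from a nearby
    [s] either to 1 or strictly past the supremum. This replaces compactness of the unit interval
    below. *)
Lemma interval_induction (R : realType) (P : R -> Prop) : P 0 ->
  (forall t, 0 <= t <= 1 -> exists2 r, 0 < r &
     forall s u, 0 <= s <= t -> t - r < s -> P s ->
       t <= u <= 1 -> u < t + r -> P u) ->
  P 1.
Proof.
move=> P0 step; pose S := [set t | 0 <= t <= 1 /\ P t].
have S0 : S 0 by rewrite /S /= lexx ler01.
have hS : has_sup S.
  by split; [exists 0|exists 1 => t [/andP[]]].
have Sle t : S t -> t <= sup S by apply: ub_le_sup; case: hS.
have m01 : 0 <= sup S <= 1.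
  by rewrite Sle// ge_sup//; [exists 0|move=> t [/andP[]]].
have [r r0 rP] := step _ m01.
have [s [s01 Ps] rs] := sup_adherent r0 hS.
have r2 : r / 2 < r by lra.
have r20 : 0 < r / 2 by lra.
have [m1|m1] := ltP 1 (sup S + r).
  apply: (rP s) => //; last by case/andP: m01 => _ ->; rewrite lexx.
  by rewrite Sle ?andbT//; case/andP: s01.
have Pu : P (sup S + r / 2).
  apply: (rP s) => //; last by lra.
    by rewrite Sle ?andbT//; case/andP: s01.
  by apply/andP; split; lra.
have : S (sup S + r / 2).
  by split=> //; case/andP: m01 => h1 h2; apply/andP; split; lra.
by move/Sle; lra.
Qed.

(** Interval induction on [|g t - g 0| <= (K + e) * t]. The hypothesis only compares with the centre
    [t], so a step from [s] to [u] is split at [t]. *)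
Lemma mean_value_le (R : realType) (V : normedModType R) (g : R -> V) (K : R) :
  (forall t e, 0 <= t <= 1 -> 0 < e -> exists2 r, 0 < r &
     forall s, 0 <= s <= 1 -> `|s - t| < r ->
       `|g s - g t| <= (K + e) * `|s - t|) ->
  `|g 1 - g 0| <= K.
Proof.
move=> hg; apply/ler_addgt0Pr => e e0.
suff : `|g 1 - g 0| <= (K + e) * 1 by rewrite mulr1.
apply: (interval_induction (P := fun t => `|g t - g 0| <= (K + e) * t)).
  by rewrite subrr normr0 mulr0.
move=> t t01; have [r r0 rP] := hg t e t01 e0; exists r => //.
move=> s u /andP[s0 st] rs Ps /andP[tu u1] ur.
have ut : `|g u - g t| <= (K + e) * (u - t).
  have := rP u; rewrite ger0_norm ?subr_ge0//; apply.
    by apply/andP; split; lra.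
  by lra.
have ts : `|g s - g t| <= (K + e) * (t - s).
  have := rP s; rewrite distrC ger0_norm ?subr_ge0//; apply.
    by case/andP: t01 => t0 t1; apply/andP; split; lra.
  by lra.
have -> : g u - g 0 = (g u - g t) - (g s - g t) + (g s - g 0).
  by rewrite opprB subrKA subrKA.
apply: le_trans (ler_normD _ _) _.
have := ler_normB (g u - g t) (g s - g t); lra.
Qed.

Lemma continuous_linear_le (R : realType) (V W : normedModType R)
    (L : {linear V -> W}) : continuous L ->
  exists2 M, 0 < M & forall v, `|L v| <= M * `|v|.
Proof.
move=> /linear_bounded_continuous/linear_boundedP/pinfty_ex_gt0[M M0 hM].
by exists M.
Qed.

(** The bound [M] makes the supremum in [opnorm] genuine. [L] is a bare function because it will be
    a difference of two differentials. *)
Lemma le_opnorm (R : realType) (V W : normedModType R) (L : V -> W) (M : R)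
    (v : V) :
  (forall u, `|L u| <= M * `|u|) -> (forall a u, L (a *: u) = a *: L u) ->
  `|L v| <= opnorm L * `|v|.
Proof.
move=> LM LZ; have [->|v0] := eqVneq v 0.
  by have := LM 0; rewrite normr0 !mulr0.
have nv0 : 0 < `|v| by rewrite normr_gt0.
rewrite -ler_pdivrMr//; apply: ub_le_sup.
  exists `|M| => _ [u /= u1 <-]; apply: le_trans (LM u) _.
  apply: le_trans (ler_norm _) _.
  by rewrite normrM normr_id ler_piMr.
exists (`|v|^-1 *: v) => /=; first by rewrite normrZ normfV normr_id mulVf ?gt_eqF.
by rewrite LZ normrZ normfV normr_id mulrC.
Qed.

Lemma C1_diff_le (R : realType) (X Y : normedModType R) (f : X -> Y) (x : X)
    (e : R) : C1 f -> 0 < e ->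
  exists2 r, 0 < r & forall z, `|z - x| < r ->
    forall v, `|'d f z v - 'd f x v| <= e * `|v|.
Proof.
move=> [df dfc] e0.
have /cvgrPdist_lt/(_ e e0)/nbhs_ballP[r /= r0 rP] := dfc x.
exists r => // z zr v.
have [M1 _ hM1] := continuous_linear_le (diff_continuous (df z)).
have [M2 _ hM2] := continuous_linear_le (diff_continuous (df x)).
have h : `|'d f z v - 'd f x v| <=
    opnorm (fun v => 'd f z v - 'd f x v) * `|v|.
  apply: (@le_opnorm R X Y (fun v => 'd f z v - 'd f x v) (M1 + M2)) => [u|a u].
    apply: le_trans (ler_normB _ _) _.
    by rewrite mulrDl; apply: lerD.
  have dZ z' : 'd f z' (a *: u) = a *: 'd f z' u by rewrite linearZ.
  by rewrite !dZ scalerBr.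
apply: le_trans h _.
rewrite ler_wpM2r//; have := rP z; rewrite -ball_normE /= distrC => /(_ zr).
by rewrite sub0r normrN => /ltW; apply: le_trans; exact: ler_norm.
Qed.

(** Mean value inequality for [f (z + s *: h) - s *: 'd f x h], whose derivative in [s] is the value
    at [h] of ['d f (z + s *: h) - 'd f x]; halving the radius keeps the whole segment where this is
    at most [e * |h|]. *)
Lemma C1_strict_diff (R : realType) (X Y : normedModType R) (f : X -> Y) (x : X)
    (e : R) : C1 f -> 0 < e ->
  exists2 r, 0 < r & forall z h, `|z - x| < r -> `|h| < r ->
    `|f (z + h) - f z - 'd f x h| <= e * `|h|.
Proof.
move=> Cf e0; have [r r0 rP] := C1_diff_le x Cf e0.
exists (r / 2); first by rewrite divr_gt0.
move=> z h zr hr.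
pose g (s : R) := f (z + s *: h) - s *: 'd f x h.
have -> : f (z + h) - f z - 'd f x h = g 1 - g 0.
  by rewrite /g !scale1r !scale0r addr0 subr0 addrAC.
apply: mean_value_le => t e' /andP[t0 t1] e'0.
have [h0|h0] := eqVneq h 0.
  have gE u : g u = f z.
    have d0 : 'd f x 0 = 0 by exact: linear0.
    by rewrite /g h0 d0 !scaler0 addr0 subr0.
  exists 1 => // s _ _; rewrite !gE subrr normr0 mulr_ge0//.
  by rewrite addr_ge0 ?mulr_ge0// ltW.
have nh0 : 0 < `|h| by rewrite normr_gt0.
have zt : `|z + t *: h - x| < r.
  rewrite addrAC; apply: le_lt_trans (ler_normD _ _) _.
  rewrite normrZ (ger0_norm t0).
  have : t * `|h| <= `|h| by rewrite ler_piMl.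
  by lra.
have e'h : 0 < e' / `|h| by rewrite divr_gt0.
have [r' r'0 r'P] := differentiable_eps (proj1 Cf (z + t *: h)) e'h.
exists (r' / `|h|); first by rewrite divr_gt0.
move=> s _; rewrite ltr_pdivlMr// => sr'.
have := r'P ((s - t) *: h); rewrite normrZ => /(_ sr').
have -> : z + t *: h + (s - t) *: h = z + s *: h.
  by rewrite -addrA -scalerDl (addrC t) subrK.
have -> : 'd f (z + t *: h) ((s - t) *: h) = (s - t) *: 'd f (z + t *: h) h.
  by rewrite linearZ.
set A := f (z + s *: h); set B := f (z + t *: h); set D := 'd f _ h.
have := rP _ zt h; rewrite -/D => h1 h2.
have -> : g s - g t = (A - B - (s - t) *: D) + (s - t) *: (D - 'd f x h).
  by rewrite /g -/A -/B scalerBr addrA subrK scalerBl opprD addrACA opprD.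
apply: le_trans (ler_normD _ _) _; rewrite normrZ.
have h3 := ler_wpM2l (normr_ge0 (s - t)) h1.
apply: le_trans (lerD h2 h3) _; rewrite le_eqVlt; apply/orP; left.
by apply/eqP; field; rewrite gt_eqF.
Qed.

(** * Stability and continuous selection of descent directions *)

Lemma sqr_norm_drop_near (R : realType) (V : normedModType R) (U k : V)
    (mu t : R) : 0 <= mu -> 0 < t ->
  `|U + t *: k| ^+ 2 + 2 * mu * t < `|U| ^+ 2 ->
  exists2 eta, 0 < eta & forall U' k', `|U' - U| <= eta -> `|k' - k| <= eta ->
    `|U' + t *: k'| ^+ 2 + 2 * mu * t < `|U'| ^+ 2.
Proof.
move=> mu0 t0; set A := `|U + t *: k|; set B := `|U| => AB.
have A0 : 0 <= A by exact: normr_ge0.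
have B0 : 0 < B.
  rewrite lt_neqAle normr_ge0 andbT; apply: contraTneq AB => <-.
  by rewrite expr0n -leNgt addr_ge0 ?sqr_ge0// !mulr_ge0// ltW.
pose s := B ^+ 2 - A ^+ 2 - 2 * mu * t.
have s0 : 0 < s by rewrite /s; lra.
pose c := 1 + t.
have c0 : 0 < c by rewrite /c; lra.
(* For [eta <= 1], [(A + eta * c) ^+ 2 - (B - eta) ^+ 2] is at most [A ^+ 2 - B ^+ 2 + eta * K], and
   the choice of [eta] keeps [eta * K] within half of the slack [s]. *)
pose K := 2 * A * c + 2 * B + c ^+ 2.
have K0 : 0 < K.
  have := mulr_ge0 A0 (ltW c0); have := exprn_gt0 2 c0; rewrite /K; lra.
exists (Num.min 1 (Num.min B (s / K / 2))).
  by rewrite !lt_min ltr01 B0 !divr_gt0.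
move=> U' k'; set eta := Num.min _ _ => hU hk.
have eta1 : eta <= 1 by rewrite ge_min lexx.
have etaB : eta <= B by rewrite !ge_min lexx !orbT.
have etas : eta <= s / K / 2 by rewrite !ge_min lexx !orbT.
have eta0 : 0 <= eta by apply: le_trans hU.
have etaK : eta * K < s.
  have : eta * K <= s / K / 2 * K by rewrite ler_wpM2r// ltW.
  have -> : s / K / 2 * K = s / 2 by field; rewrite gt_eqF.
  lra.
have hA : `|U' + t *: k'| <= A + eta * c.
  have -> : U' + t *: k' = (U + t *: k) + ((U' - U) + t *: (k' - k)).
    by rewrite scalerBr addrACA (addrC U) subrK (addrC (t *: k)) subrK.
  apply: le_trans (ler_normD _ _) _; rewrite lerD2l.
  apply: le_trans (ler_normD _ _) _; rewrite normrZ gtr0_norm//.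
  have := ler_wpM2l (ltW t0) hk; rewrite /c; lra.
have hB : B - eta <= `|U'|.
  have := ler_normB U' (U' - U); rewrite opprB addrC subrK -/B; lra.
have hA2 : `|U' + t *: k'| ^+ 2 <= (A + eta * c) ^+ 2.
  by rewrite lerXn2r ?nnegrE// addr_ge0// mulr_ge0// ltW.
have hB2 : (B - eta) ^+ 2 <= `|U'| ^+ 2.
  by rewrite lerXn2r ?nnegrE// subr_ge0.
have ec : eta ^+ 2 * c ^+ 2 <= eta * c ^+ 2.
  by rewrite ler_wpM2r ?sqr_ge0// expr2 ler_piMl.
by move: etaK hA2 hB2 ec (sqr_ge0 eta); rewrite /K /s; lra.
Qed.

(** [U + s *: k] lies on the segment from [U] to [U + t *: k], along which the squared norm is
    convex. *)
Lemma sqr_norm_drop_shrink (R : realType) (V : normedModType R) (U k : V)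
    (mu s t : R) : 0 < s <= t ->
  `|U + t *: k| ^+ 2 + 2 * mu * t < `|U| ^+ 2 ->
  `|U + s *: k| ^+ 2 + 2 * mu * s < `|U| ^+ 2.
Proof.
move=> /andP[s0 st] h; have t0 := lt_le_trans s0 st.
have st0 : 0 < s / t by rewrite divr_gt0.
have st1 : 0 <= s / t <= 1 by rewrite ltW//= ler_pdivrMr// mul1r.
have := sqr_norm_convex (U + t *: k) U st1.
have -> : (s / t) *: (U + t *: k) + (1 - s / t) *: U = U + s *: k.
  rewrite scalerDr scalerA divfK ?gt_eqF// addrAC -scalerDl.
  by rewrite (addrC (s / t)) subrK scale1r.
have : s / t * (`|U + t *: k| ^+ 2 + 2 * mu * t) < s / t * `|U| ^+ 2.
  by rewrite ltr_pM2l.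
have -> : s / t * (`|U + t *: k| ^+ 2 + 2 * mu * t) =
    s / t * `|U + t *: k| ^+ 2 + 2 * mu * s by field; rewrite gt_eqF.
lra.
Qed.

(** Both decreases are first brought to a common [t]; there the squared norm is convex in the
    direction. *)
Lemma descent_direction_convex (R : realType) (X Y : normedModType R)
    (f : X -> Y) (y : Y) (mu : R) (x w1 w2 : X) (a : R) :
  0 <= a <= 1 ->
  descent_direction f y mu x w1 -> descent_direction f y mu x w2 ->
  descent_direction f y mu x (a *: w1 + (1 - a) *: w2).
Proof.
move=> a01 [w1b [t1 t10 ht1]] [w2b [t2 t20 ht2]]; split.
  apply: le_trans (ler_normD _ _) _; case/andP: a01 => a0 a1.
  rewrite !normrZ !ger0_norm ?subr_ge0//.
  have := ler_wpM2l a0 w1b; have : 0 <= 1 - a by lra.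
  by move/ler_wpM2l => /(_ _ _ w2b); lra.
pose t := Num.min t1 t2; have t0 : 0 < t by rewrite lt_min t10.
exists t => //.
have tt1 : 0 < t <= t1 by rewrite t0 ge_min lexx.
have tt2 : 0 < t <= t2 by rewrite t0 ge_min lexx orbT.
set U := f x - y in ht1 ht2 *.
have {ht1} := sqr_norm_drop_shrink tt1 ht1.
have {ht2} := sqr_norm_drop_shrink tt2 ht2.
have -> : 'd f x (a *: w1 + (1 - a) *: w2) =
    a *: 'd f x w1 + (1 - a) *: 'd f x w2 by rewrite linearD !linearZ.
set k1 := 'd f x w1; set k2 := 'd f x w2 => h2 h1.
have := sqr_norm_convex (U + t *: k1) (U + t *: k2) a01.
have -> : a *: (U + t *: k1) + (1 - a) *: (U + t *: k2) =
    U + t *: (a *: k1 + (1 - a) *: k2).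
  rewrite (scalerDr a U) (scalerDr (1 - a) U) addrACA -scalerDl.
  rewrite (addrC a) subrK scale1r scalerDr !scalerA.
  by rewrite (mulrC a) (mulrC (1 - a)).
case/andP: a01 => a0 a1 /le_lt_trans; rewrite -ltrBrDr; apply.
(* Strictness is taken from the [w1] term, which disappears when [a = 0]. *)
have [->|a0'] := eqVneq a 0; first by rewrite subr0; lra.
have ap : 0 < a by rewrite lt_neqAle eq_sym a0'.
have h1' : a * (`|U + t *: k1| ^+ 2 + 2 * mu * t) < a * `|U| ^+ 2.
  by rewrite ltr_pM2l.
have h2' : (1 - a) * (`|U + t *: k2| ^+ 2 + 2 * mu * t) <=
    (1 - a) * `|U| ^+ 2 by rewrite ler_wpM2l ?subr_ge0// ltW.
move: h1' h2'; rewrite !mulrDr; lra.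
Qed.

Lemma C1_lipschitz_near (R : realType) (X Y : normedModType R) (f : X -> Y)
    (x : X) : C1 f ->
  exists2 L, 0 < L & exists2 r, 0 < r &
    forall z, `|z - x| < r -> `|f z - f x| <= L * `|z - x|.
Proof.
move=> [df _]; have [M M0 hM] := continuous_linear_le (diff_continuous (df x)).
have [r r0 rP] := differentiable_eps (df x) ltr01.
exists (M + 1); first by lra.
exists r => // z /rP; rewrite [x + _]addrC subrK mul1r => h.
have -> : f z - f x = (f z - f x - 'd f x (z - x)) + 'd f x (z - x).
  by rewrite subrK.
apply: le_trans (ler_normD _ _) _; have := hM (z - x); lra.
Qed.

Lemma descent_direction_near (R : realType) (X Y : normedModType R)
    (f : X -> Y) (y : Y) (mu : R) (x w : X) : C1 f -> 0 <= mu ->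
  descent_direction f y mu x w ->
  exists2 r, 0 < r & forall z, `|z - x| < r -> descent_direction f y mu z w.
Proof.
move=> Cf mu0 [w1 [t t0 ht]].
have [eta eta0 hr] := sqr_norm_drop_near mu0 t0 ht.
have [L L0 [r1 r10 hL]] := C1_lipschitz_near x Cf.
have [r2 r20 hd] := C1_diff_le x Cf eta0.
exists (Num.min r1 (Num.min r2 (eta / L))).
  by rewrite !lt_min r10 r20 divr_gt0.
move=> z; rewrite !lt_min => /and3P[zr1 zr2 zr3]; split=> //; exists t => //.
apply: hr.
  rewrite opprB subrKA; apply: le_trans (hL _ zr1) _.
  by rewrite mulrC -ler_pdivlMr// ltW.
apply: le_trans (hd _ zr2 w) _.
by rewrite ler_piMr// ltW.
Qed.

(** By strict differentiability the difference quotient [k'] of [f] between [z] and [z + s *: v] is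
    within [eta] of ['d f x w]. The perturbed inequality holds for [k'] at [t], hence at [s], where
    [f z + s *: k'] is exactly [f (z + s *: v)]. *)
Lemma descent_direction_decrease (R : realType) (X Y : normedModType R)
    (f : X -> Y) (y : Y) (mu : R) (x w : X) : C1 f -> 0 <= mu ->
  descent_direction f y mu x w ->
  exists2 r, 0 < r & forall z v s, `|z - x| < r -> `|v - w| < r ->
    0 <= s < r ->
    half_sqdist f y (z + s *: v) <= half_sqdist f y z - mu * s.
Proof.
move=> Cf mu0 [w1 [t t0 ht]].
have [eta eta0 hr] := sqr_norm_drop_near mu0 t0 ht.
have [L L0 [r1 r10 hL]] := C1_lipschitz_near x Cf.
(* Since [|v| <= 2] below, this error moves [k'] by at most [eta / 2]; the other half is left for
   ['d f x (v - w)]. *)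
have e40 : 0 < eta / 4 by rewrite divr_gt0.
have [r2 r20 hs] := C1_strict_diff x Cf e40.
have [M M0 hM] := continuous_linear_le (diff_continuous (proj1 Cf x)).
exists (Num.min (Num.min (Num.min r1 r2) (Num.min (eta / L) (eta / M / 2)))
  (Num.min 1 (Num.min t (r2 / 2)))).
  by rewrite !lt_min r10 r20 t0 ltr01 !divr_gt0.
move=> z v s; rewrite !lt_min => /andP[/and3P[/andP[zr1 zr2] zr3 _] _].
move=> /andP[/and3P[_ _ vr1] /and3P[vr2 _ _]].
move=> /andP[s0 /andP[_ /and3P[sr1 sr2 sr3]]].
move: s0; rewrite le_eqVlt => /predU1P[<-|s0].
  by rewrite scale0r addr0 mulr0 subr0.
have v2 : `|v| <= 2.
  have := ler_normD (v - w) w; rewrite subrK; lra.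
have svr : `|s *: v| < r2.
  rewrite normrZ gtr0_norm//.
  have : s * `|v| <= s * 2 by rewrite ler_wpM2l// ltW.
  lra.
have := hs z (s *: v) zr2 svr.
pose k' := s^-1 *: (f (z + s *: v) - f z).
have fE : f (z + s *: v) = f z + s *: k'.
  by rewrite /k' scalerA mulfV ?gt_eqF// scale1r [RHS]addrC subrK.
have -> : f (z + s *: v) - f z - 'd f x (s *: v) = s *: (k' - 'd f x v).
  have -> : 'd f x (s *: v) = s *: 'd f x v by rewrite linearZ.
  by rewrite fE (addrC (f z)) addrK scalerBr.
rewrite !normrZ gtr0_norm// mulrCA ler_pM2l// => hk'.
have hk : `|k' - 'd f x w| <= eta.
  have -> : k' - 'd f x w = (k' - 'd f x v) + 'd f x (v - w).
    by rewrite linearB subrKA.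
  apply: le_trans (ler_normD _ _) _.
  have h1 : eta / 4 * `|v| <= eta / 4 * 2 by rewrite ler_wpM2l// ltW.
  have h2 : `|'d f x (v - w)| <= eta / 2.
    apply: le_trans (hM _) _.
    rewrite mulrC -ler_pdivlMr// ltW//; apply: lt_le_trans vr1 _.
    by rewrite mulrAC.
  lra.
have hU : `|(f z - y) - (f x - y)| <= eta.
  rewrite opprB subrKA; apply: le_trans (hL _ zr1) _.
  by rewrite mulrC -ler_pdivlMr// ltW.
have st : 0 < s <= t by rewrite s0 ltW.
have := sqr_norm_drop_shrink st (hr _ _ hU hk).
rewrite /half_sqdist fE addrAC; lra.
Qed.

(** Interval induction replaces a partition of unity: a selection valid up to [s] is blended with a
    constant one valid around [t], and convexity keeps the blend admissible on the overlap. *)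
Lemma convex_selection (R : realType) (V : normedModType R) (G : R -> set V) :
  (forall t u v a, 0 <= a <= 1 -> G t u -> G t v ->
     G t (a *: u + (1 - a) *: v)) ->
  (forall t, 0 <= t <= 1 -> exists v, exists2 r, 0 < r &
     forall s, `|s - t| < r -> G s v) ->
  exists2 w : R -> V, continuous w & forall t, 0 <= t <= 1 -> G t (w t).
Proof.
move=> Gconv Gloc.
apply: (interval_induction (P := fun u => exists2 w : R -> V, continuous w &
  forall t, 0 <= t <= u -> G t (w t))).
  have [|v [r r0 rP]] := Gloc 0; first by rewrite lexx ler01.
  exists (fun=> v); first exact: cst_continuous.
  by move=> t /le_anti<-; apply: rP; rewrite subrr normr0.
move=> t t01; have [v [r r0 rP]] := Gloc t t01; exists r => //.
move=> s u /andP[s0 st] trs [w cw wG] /andP[tu u1] utr.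
have d0 : 0 < s - (t - r) by lra.
(* A ramp that is 0 up to [t - r], where [v] may fail, and 1 from [s] on, beyond which [w] may
   fail. *)
pose chi (x : R) := Num.max 0 (Num.min 1 ((x - (t - r)) / (s - (t - r)))).
have chi01 x : 0 <= chi x <= 1.
  by rewrite le_max lexx ge_max ler01 ge_min lexx.
have cchi : continuous chi.
  move=> x; apply: (@continuous_max _ _ (cst 0)
    (fun x => Num.min 1 ((x - (t - r)) / (s - (t - r))))).
    exact: cvg_cst.
  apply: (@continuous_min _ _ (cst 1)
    (fun x => (x - (t - r)) / (s - (t - r)))); first exact: cvg_cst.
  apply: cvgM; last exact: cvg_cst.
  by apply: cvgB; [exact: cvg_id|exact: cvg_cst].
exists (fun x => chi x *: v + (1 - chi x) *: w x).
  move=> x; apply: cvgD; apply: cvgZ.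
  - exact: cchi.
  - exact: cvg_cst.
  - by apply: cvgB; [exact: cvg_cst|exact: cchi].
  - exact: cw.
move=> x /andP[x0 xu].
have [xs|sx] := leP x s.
  have Gw : G x (w x) by apply: wG; rewrite x0.
  have [xt|tx] := leP x (t - r).
    suff -> : chi x = 0 by rewrite scale0r add0r subr0 scale1r.
    rewrite /chi; apply/max_idPl; rewrite ge_min; apply/orP; right.
    by rewrite pmulr_lle0 ?invr_gt0// subr_le0.
  apply: Gconv => //; apply: rP; rewrite ltr_norml; apply/andP; split; lra.
suff -> : chi x = 1.
  rewrite scale1r subrr scale0r addr0; apply: rP.
  rewrite ltr_norml; apply/andP; split; lra.
rewrite /chi; have -> : Num.min 1 ((x - (t - r)) / (s - (t - r))) = 1.
  by apply/min_idPl; rewrite ler_pdivlMr// mul1r; lra.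
by apply/max_idPr.
Qed.

(** * The weight *)

(** For the integral of [1 / (1 + h)] from 0, monotonicity of [h] bounds increments by the value at
    the left end, and divergence gives unboundedness. *)
Lemma weight_primitive (R : realType) (h : R -> R) :
  (forall rho, 0 <= rho -> 0 <= h rho) ->
  {within `[0, +oo[, continuous h} ->
  (forall r s, 0 <= r -> r <= s -> h r <= h s) ->
  (\int[@lebesgue_measure R]_(rho in `[0%R, +oo[)
      ((1 + h rho)^-1)%:E)%E = +oo%E ->
  exists phi : R -> R,
    [/\ forall a b, 0 <= a -> a <= b -> phi a <= phi b,
        forall a b, 0 <= a -> a <= b -> phi b - phi a <= (b - a) / (1 + h a) &
        forall M, exists2 r, 0 <= r & M < phi r].
Proof.
move=> h0 hc hnd hint.
pose g x := (1 + h x)^-1.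
have h1 x : 0 <= x -> 0 < 1 + h x by move=> /h0; lra.
have g0 x : 0 <= x -> 0 <= g x by move=> /h1 ?; rewrite invr_ge0 ltW.
have gc : {within `[0, +oo[, continuous g}.
  have /continuous_within_itvcyP[hin h0r] := hc.
  apply/continuous_within_itvcyP; split.
    move=> x x0; apply: cvgV.
      by rewrite gt_eqF// h1//; move: x0; rewrite in_itv/= andbT => /ltW.
    by apply: cvgD; [exact: cvg_cst|exact: hin].
  by apply: cvgV; [rewrite gt_eqF// h1|apply: cvgD => //; exact: cvg_cst].
have gi b : (@lebesgue_measure R).-integrable `[0, b] (EFin \o g).
  apply: continuous_compact_integrable; first exact: segment_compact.
  apply: continuous_subspaceW gc => x /=.
  by rewrite !in_itv/= andbT => /andP[].
have ci a b c : (@lebesgue_measure R).-integrable `]a, b] (EFin \o cst c).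
  have H : (@lebesgue_measure R).-integrable `[a, b] (EFin \o cst c).
    apply: continuous_compact_integrable; first exact: segment_compact.
    by apply: continuous_subspaceT; exact: cst_continuous.
  apply: integrableS H => // x /=.
  by rewrite !in_itv/= => /andP[/ltW -> ->].
have gi2 a b : 0 <= a -> (@lebesgue_measure R).-integrable `]a, b] (EFin \o g).
  move=> a0; apply: integrableS (gi b) => // x /=.
  by rewrite !in_itv/= => /andP[ax ->]; rewrite andbT (le_trans a0)// ltW.
pose phi b := \int[@lebesgue_measure R]_(x in `[0, b]) g x.
have phiB a b : 0 <= a -> a <= b ->
    phi b - phi a = \int[@lebesgue_measure R]_(x in `]a, b]) g x.
  by move=> a0 ab; apply: Rintegral_itvB => //; rewrite bnd_simp.
exists phi; split.
- move=> a b a0 ab; rewrite -subr_ge0 phiB//; apply: Rintegral_ge0 => x /=.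
  by rewrite in_itv/= => /andP[ax _]; rewrite g0// (le_trans a0)// ltW.
- move=> a b a0 ab; rewrite phiB//.
  apply: (@le_trans _ _ (\int[@lebesgue_measure R]_(x in `]a, b]) (g a))).
    apply: le_Rintegral => //; first exact: gi2.
      exact: ci.
    move=> x /=; rewrite in_itv/= => /andP[ax _].
    rewrite lef_pV2 ?posrE ?h1//; first by rewrite lerD2l hnd// ltW.
    by rewrite (le_trans a0)// ltW.
  rewrite Rintegral_cst//.
  rewrite [fine _](congr1 fine (lebesgue_measure_itv `]a, b])) /= lte_fin.
  case: ifPn => [_|]; first by rewrite -EFinB/= mulrC.
  by rewrite -leNgt => ba; rewrite mulr0 divr_ge0 ?subr_ge0// ltW// h1.
move=> M; apply: contrapT => nM.
have phiM r : 0 <= r -> phi r <= M.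
  by move=> r0; rewrite leNgt; apply/negP => hr; apply: nM; exists r.
(* If [phi] were bounded by [M], monotone convergence along the intervals [[0, n]] would bound the
   divergent integral by [M]. *)
have := @ge0_nondecreasing_set_cvg_integral _ (measurableTypeR R) R
  (fun n => `[0, n%:R]%classic)
  (EFin \o g) (@lebesgue_measure R) _ _ _ _.
have -> : \bigcup_n `[0, n%:R]%classic = `[0, +oo[%classic :> set R.
  apply/seteqP; split=> x /=.
    by move=> [n _] /=; rewrite !in_itv/= andbT => /andP[].
  rewrite in_itv/= andbT => x0; exists (Num.truncn x).+1 => //=.
  by rewrite in_itv/= x0/= ltW// truncnS_gt.
rewrite hint => H.
have : (+oo <= M%:E)%E.
  apply: (@cvge_le _ _ _ _
    (fun n => \int[@lebesgue_measure R]_(x in `[0%R, n%:R]) (EFin \o g) x)%E);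
    last first.
    apply: H.
    + move=> m n mn; apply/subsetPset => x /=; rewrite !in_itv/= => /andP[->].
      by move=> /= xm; rewrite (le_trans xm)// ler_nat.
    + by move=> n; exact: measurable_itv.
    + by move=> n; exact: measurable_int (gi n%:R).
    + by move=> n x /=; rewrite in_itv/= => /andP[x0 _]; rewrite lee_fin g0.
  apply: nearW => n.
  have := phiM n%:R (ler0n _ _).
  rewrite /phi /Rintegral -lee_fin fineK//.
  exact: integrable_fin_num.
  exact: eventually_filter.
by [].
Qed.

(** * Bounded inverse *)

(** The first hypothesis makes [r] nondecreasing; being bounded, it forces [s] to be Cauchy. This
    serves both a series of corrections and the limit of paths. *)
Lemma cvg_dominated_increments (R : realType) (V : completeNormedModType R)
    (s : nat -> V) (r : nat -> R) (M : R) :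
  (forall n m, (n <= m)%N -> `|s m - s n| <= r m - r n) ->
  (forall n, r n <= M) ->
  exists2 l, s n @[n --> \oo] --> l &
    forall n, `|l - s n| <= sup (range r) - r n.
Proof.
move=> sr rM.
have hS : has_sup (range r).
  by split; [exists (r 0%N), 0%N|exists M => _ [n _ <-]].
have rle n : r n <= sup (range r) by apply: ub_le_sup; [case: hS|exists n].
have cs : cvg (s n @[n --> \oo]).
  suff : cauchy (s n @[n --> \oo]) by exact: cauchy_cvg.
  suff : cauchy_ex (s n @[n --> \oo]) by exact: cauchy_exP.
  move=> e e0; rewrite /fmapE -ball_normE /ball_.
  have [_ [N _ <-] hN] := sup_adherent e0 hS.
  exists (s N), N => // m /= Nm; rewrite distrC.
  by apply: le_lt_trans (sr _ _ Nm) _; have := rle m; lra.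
move: cs; rewrite cvg_ex /= => -[l sl]; exists l => // n.
apply/ler_addgt0Pr => e e0.
have /cvgrPdist_lt/(_ e e0)[N _ hN] := sl.
pose m := maxn N n.
have := hN m (leq_maxl _ _); have := sr n m (leq_maxr _ _); have := rle m.
have -> : l - s n = (l - s m) + (s m - s n) by rewrite subrKA.
have := ler_normD (l - s m) (s m - s n); lra.
Qed.

(* The Baire category half of the open mapping theorem. *)
Lemma linear_surj_approx (R : realType) (X : normedModType R)
    (Y : completeNormedModType R) (A : {linear X -> Y}) :
  (forall y, exists x, A x = y) ->
  exists2 C, 0 < C & forall y e, 0 < e ->
    exists2 x, `|x| <= C * `|y| & `|y - A x| < e.
Proof.
move=> Asurj.
(* By surjectivity no point lies in every [G n], so by Baire some [G n] is not dense: the closure of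
   the image of a ball contains a ball around some [y0]. *)
pose G (n : nat) := ~` closure [set A x | x in [set x : X | `|x| <= n%:R]].
have [n nG] : exists n, ~ dense (G n).
  apply: contrapT => hG.
  have dG : dense (\bigcap_i G i).
    apply: Baire => i; split; first exact/closed_openC/closed_closure.
    by apply: contrapT => h; apply: hG; exists i.
  have [|y [_ hy]] := dG setT _ openT; first by exists 0.
  have [x Ax] := Asurj y.
  apply: (hy (Num.truncn `|x|).+1 I); apply: subset_closure.
  by exists x => //=; rewrite ltW// truncnS_gt.
have [W [[y0 Oy0] /disjoints_subset OG]] := denseNE nG.
have /nbhs_ballP[r /= r0 rO] := open_nbhs_nbhs Oy0.
have Oapp z e : `|z - y0| < r -> 0 < e ->
    exists2 x, `|x| <= n%:R & `|z - A x| < e.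
  move=> zr e0; have /OG : W z by apply: rO; rewrite -ball_normE /= distrC.
  rewrite setCK => /(_ (ball z e)) [|_ [[x /= xn <-]]].
    exact: nbhsx_ballx.
  by rewrite -ball_normE /=; exists x.
(* [y], scaled to norm [r / 2], is the difference of [y0 + a *: y] and [y0], which have approximate
   preimages of norm at most [n]. Undoing the scaling gives [4 * n / r]; [n.+1] keeps it
   positive. *)
pose C : R := 4 * n.+1%:R / r.
have C0 : 0 < C by rewrite divr_gt0// mulr_gt0.
exists C => // y e e0.
have [->|y0'] := eqVneq y 0.
  by exists 0; rewrite ?normr0 ?mulr0// linear0 subr0 normr0.
have ny : 0 < `|y| by rewrite normr_gt0.
pose a := r / 2 / `|y|.
have a0 : 0 < a by rewrite !divr_gt0.
have ea : 0 < e * a / 2 by rewrite divr_gt0// mulr_gt0.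
have [|x1 hx1 hy1] := Oapp (y0 + a *: y) (e * a / 2) _ ea.
  rewrite addrC addKr normrZ gtr0_norm// /a divfK ?gt_eqF//; lra.
have [|x2 hx2 hy2] := Oapp y0 (e * a / 2) _ ea; first by rewrite subrr normr0.
exists (a^-1 *: (x1 - x2)).
  rewrite normrZ gtr0_norm ?invr_gt0//.
  have -> : C * `|y| = a^-1 * (2 * n.+1%:R).
    by rewrite /C /a; field; rewrite !gt_eqF.
  rewrite ler_pM2l ?invr_gt0//; apply: le_trans (ler_normB _ _) _.
  have : (n%:R : R) <= n.+1%:R by rewrite ler_nat.
  lra.
have -> : A (a^-1 *: (x1 - x2)) = a^-1 *: (A x1 - A x2).
  by rewrite linearZ/= linearB.
have -> : y - a^-1 *: (A x1 - A x2) =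
    a^-1 *: ((y0 + a *: y - A x1) - (y0 - A x2)).
  have -> : y0 + a *: y - A x1 - (y0 - A x2) = a *: y - (A x1 - A x2).
    by rewrite (addrC y0) addrAC addrKA opprK opprB addrA.
  by rewrite [RHS]scalerBr scalerA mulVf ?gt_eqF// scale1r.
rewrite normrZ gtr0_norm ?invr_gt0// ltr_pdivrMl//.
apply: le_lt_trans (ler_normB _ _) _; lra.
Qed.

(** Approximate preimages of the successive residuals are added up: the residuals decay like
    [2^-n |y|], the corrections sum to at most [2 * C * |y|], and by injectivity the limit is
    [x0]. *)
Lemma linear_bij_ge (R : realType) (X Y : completeNormedModType R)
    (A : {linear X -> Y}) : continuous A -> bijective A ->
  exists2 k, 0 < k & forall x, k * `|x| <= `|A x|.
Proof.
move=> Ac [B AB BA].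
have [|C C0 hC] := @linear_surj_approx R X Y A.
  by move=> y; exists (B y); rewrite BA.
exists (2 * C)^-1; first by rewrite invr_gt0 mulr_gt0.
move=> x0; rewrite ler_pdivrMl ?mulr_gt0//; set y := A x0.
have [y0|y0] := eqVneq y 0.
  have -> : x0 = 0 by apply: (can_inj AB); rewrite linear0.
  by rewrite y0 !normr0 mulr0.
have ny : 0 < `|y| by rewrite normr_gt0.
pose e := geometric `|y| (2^-1 : R).
have e0 i : 0 < e i by rewrite /e /= mulr_gt0// exprn_gt0// invr_gt0.
have eS i : e i.+1 = e i / 2 by rewrite /e /= exprSr mulrA.
have /choice[step hstep] (ui : X * nat) : exists u',
    `|u' - ui.1| <= C * `|y - A ui.1| /\ `|y - A u'| < e ui.2.+1.
  have [v hv1 hv2] := hC (y - A ui.1) _ (e0 ui.2.+1).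
  exists (ui.1 + v); rewrite [ui.1 + v]addrC addrK; split=> //.
  by rewrite linearD/= opprD addrA addrAC.
pose fix s n := if n is m.+1 then step (s m, m) else 0.
have hs i : `|y - A (s i)| <= e i.
  case: i => [|i]; first by rewrite /= linear0 subr0 /e /= expr0 mulr1.
  by rewrite ltW//; have [_] := hstep (s i, i).
(* The dominating sequence consists of the partial sums of the bounds [C * e i] on the
   corrections. *)
have [|n|l sl hl] := @cvg_dominated_increments R X s
    (fun n => 2 * C * (`|y| - e n)) (2 * C * `|y|).
- move=> n m /subnK <-; elim: (m - n)%N => [|k IH].
    by rewrite add0n !subrr normr0.
  have [h _] := hstep (s (k + n)%N, (k + n)%N).
  have h' : C * `|y - A (s (k + n)%N)| <= C * e (k + n)%N.
    by rewrite ler_wpM2l// ltW.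
  rewrite addSn eS.
  have -> : s (k + n).+1 - s n = (s (k + n).+1 - s (k + n)%N) + (s (k + n)%N - s n).
    by rewrite subrKA.
  apply: le_trans (ler_normD _ _) _.
  have : `|s (k + n).+1 - s (k + n)%N| <= C * e (k + n)%N by apply: le_trans h h'.
  move: IH; lra.
- by rewrite ler_pM2l ?mulr_gt0// gerBl ltW.
have Al : A l = y.
  have h1 : A (s n) @[n --> \oo] --> A l by apply: continuous_cvg => //; exact: Ac.
  have h2 : A (s n) @[n --> \oo] --> y.
    apply/cvgrPdist_lt => d d0.
    have /cvgrPdist_lt/(_ d d0) : e n @[n --> \oo] --> (0 : R).
      by apply: cvg_geometric; rewrite gtr0_norm ?invr_gt0// invf_lt1// ltr1n.
    apply: filterS => n; rewrite sub0r normrN gtr0_norm//.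
    exact: le_lt_trans.
  exact: (cvg_unique _ h1 h2).
have <- : l = x0 by rewrite -(AB l) Al /y AB.
have := hl 0%N; rewrite /= subr0 {2}/e /= expr0 mulr1 subrr mulr0 subr0.
move/le_trans; apply; apply: ge_sup; first by exists (2 * C * (`|y| - e 0%N)), 0%N.
by move=> _ [n _ <-]; rewrite ler_pM2l ?mulr_gt0// gerBl ltW.
Qed.

(** The differential is bounded below by a positive constant, and near [x] the remainder takes away
    at most half of it. *)
Lemma C1_isolated_preimage (R : realType) (X Y : completeNormedModType R)
    (f : X -> Y) (x : X) : C1 f -> bijective ('d f x : X -> Y) ->
  exists2 k, 0 < k & exists2 r, 0 < r &
    forall z, `|z - x| < r -> k * `|z - x| <= `|f z - f x|.
Proof.
move=> [df _] bij.
have [k k0 hk] := linear_bij_ge (diff_continuous (df x)) bij.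
have k20 : 0 < k / 2 by rewrite divr_gt0.
have [r r0 hr] := differentiable_eps (df x) k20.
exists (k / 2) => //; exists r => // z /hr; rewrite [x + _]addrC subrK => h.
have := hk (z - x); have := ler_normB (f z - f x) (f z - f x - 'd f x (z - x)).
by rewrite subKr; lra.
Qed.

(** * The mountain pass argument *)

(** Paths live on all of [R] and are constant outside the unit interval, so their continuity needs
    no subspace topology. *)
Definition path_between (R : realType) (V : normedModType R) (a b : V)
    (p : R -> V) : Prop :=
  [/\ continuous p, forall t, t <= 0 -> p t = a & forall t, 1 <= t -> p t = b].

Lemma continuous_eps (R : realType) (V W : normedModType R) (p : V -> W)
    (t : V) (e : R) : {for t, continuous p} -> 0 < e ->
  exists2 r, 0 < r & forall s, `|s - t| < r -> `|p s - p t| < e.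
Proof.
move=> /cvgrPdist_lt cp e0; have /nbhs_ballP[r /= r0 rP] := cp e e0.
exists r => // s sr; rewrite distrC; apply: rP.
by rewrite -ball_normE /= distrC.
Qed.

Lemma C1_half_sqdist_continuous (R : realType) (X Y : normedModType R)
    (f : X -> Y) (y : Y) : C1 f -> continuous (half_sqdist f y).
Proof.
move=> [df _] x; apply: cvgM; first exact: cvg_cst.
rewrite /=; under eq_fun do rewrite expr2.
have cn : `|f z - y| @[z --> x] --> `|f x - y|.
  apply: cvg_norm; apply: cvgB; last exact: cvg_cst.
  exact: differentiable_continuous.
by rewrite expr2; apply: cvgM.
Qed.

(** The same [d] measures displacement and gain; this exchange is what the ordering in
    [mountain_pass] exploits. *)
Lemma path_descent (R : realType) (X Y : normedModType R) (f : X -> Y) (y : Y)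
    (a b : X) (p : R -> X) (beta mu : R) :
  C1 f -> f a = y -> f b = y -> path_between a b p -> 0 < beta -> 0 <= mu ->
  (forall t, half_sqdist f y (p t) <= beta) ->
  (forall t, half_sqdist f y (p t) = beta ->
     exists w, descent_direction f y mu (p t) w) ->
  exists2 d, 0 < d & exists q, [/\ path_between a b q,
    forall t, `|q t - p t| <= d &
    forall t, half_sqdist f y (q t) <= beta - mu * d].
Proof.
move=> Cf fa fb [cp pa pb] beta0 mu0 pbeta hdesc.
pose F := half_sqdist f y.
have cF : continuous F by exact: C1_half_sqdist_continuous.
have Fa : F a = 0 by rewrite /F /half_sqdist fa subrr normr0 expr0n mulr0.
have Fb : F b = 0 by rewrite /F /half_sqdist fb subrr normr0 expr0n mulr0.
have F0 x : 0 <= F x by rewrite /F /half_sqdist mulr_ge0 ?sqr_ge0// invr_ge0.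
have cFp : continuous (fun t => F (p t)).
  by move=> t; apply: continuous_comp; [exact: cp|exact: cF].
(* Descent is required only at level [beta]; elsewhere 0 is admissible, and stays so nearby by
   continuity of [F]. *)
pose G t := [set w : X | `|w| <= 1 /\
  (F (p t) = beta -> descent_direction f y mu (p t) w)].
have [||w cw wG] := @convex_selection R X G.
- move=> t u v c c01 [u1 hu] [v1 hv]; split; last first.
    move=> Ft; apply: descent_direction_convex => //; [exact: hu|exact: hv].
  apply: le_trans (ler_normD _ _) _; case/andP: c01 => c0 c1.
  rewrite !normrZ !ger0_norm ?subr_ge0//.
  have : 0 <= 1 - c by lra.
  have := ler_wpM2l c0 u1.
  by move=> ? /ler_wpM2l => /(_ _ _ v1); lra.
- move=> t _; have [Ft|Ft] := eqVneq (F (p t)) beta.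
    have [v hv] := hdesc t Ft.
    have [r r0 hr] := descent_direction_near Cf mu0 hv.
    have [r' r'0 hr'] := continuous_eps (cp t) r0.
    exists v, r' => // s /hr' /hr hs; split=> //; by case: hs.
  have Flt : 0 < beta - F (p t).
    by rewrite subr_gt0 lt_neqAle Ft; exact: pbeta.
  have [r r0 hr] := continuous_eps (cFp t) Flt.
  exists 0, r => // s /hr hs; split; first by rewrite normr0.
  by move=> Fs; move: hs; rewrite Fs; rewrite ltr_norml => /andP[_]; rewrite ltxx.
(* The factor is 1 at level [beta] and 0 at the endpoints, where [F] vanishes, so the deformed path
   still joins [a] to [b]. *)
pose v t := (F (p t) / beta) *: w t.
have cv : continuous v.
  move=> t; apply: cvgZ; last exact: cw.
  by apply: cvgM; [exact: cFp|exact: cvg_cst].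
have v0 t : F (p t) = 0 -> v t = 0 by rewrite /v => ->; rewrite mul0r scale0r.
have v1 t : `|v t| <= 1.
  have [t0|t0] := leP t 0; first by rewrite v0 ?pa// normr0.
  have [t1|t1] := leP 1 t; first by rewrite v0 ?pb// normr0.
  have [|w1 _] := wG t; first by rewrite !ltW.
  rewrite normrZ ger0_norm ?divr_ge0 ?(ltW beta0)//.
  by rewrite mulr_ile1 ?divr_ge0 ?(ltW beta0)// ler_pdivrMr// mul1r; exact: pbeta.
pose Q u := exists2 d, 0 < d & forall t s, 0 <= t <= u -> 0 <= s <= d ->
  F (p t + s *: v t) <= beta - mu * s.
have Qloc t : 0 <= t <= 1 -> exists2 r, 0 < r & forall x s, `|x - t| < r ->
    0 <= s < r -> F (p x + s *: v x) <= beta - mu * s.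
  move=> t01; have [Ft|Ft] := eqVneq (F (p t)) beta.
    have vt : v t = w t by rewrite /v Ft mulfV ?gt_eqF// scale1r.
    have [_ /(_ Ft)] := wG t t01; rewrite -vt => hv.
    have [r r0 hr] := descent_direction_decrease Cf mu0 hv.
    have [r1 r10 hr1] := continuous_eps (cp t) r0.
    have [r2 r20 hr2] := continuous_eps (cv t) r0.
    exists (Num.min r (Num.min r1 r2)); first by rewrite !lt_min r0 r10.
    move=> x s; rewrite !lt_min => /and3P[_ x1 x2] /andP[s0 /and3P[sr _ _]].
    have sr' : 0 <= s < r by rewrite s0.
    apply: le_trans (hr _ _ _ (hr1 _ x1) (hr2 _ x2) sr') _.
    by rewrite lerD2r; exact: pbeta.
  (* Below level [beta], half of the gap pays for the variation of [F] and the other half for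
     [mu * s]; [mu + 1] avoids dividing by 0. *)
  have Flt : 0 < (beta - F (p t)) / 2.
    by rewrite divr_gt0// subr_gt0 lt_neqAle Ft; exact: pbeta.
  have [r1 r10 hr1] := continuous_eps (cF (p t)) Flt.
  have r120 : 0 < r1 / 2 by rewrite divr_gt0.
  have [r2 r20 hr2] := continuous_eps (cp t) r120.
  have mu1 : 0 < mu + 1 by lra.
  exists (Num.min r2 (Num.min (r1 / 2) ((beta - F (p t)) / 2 / (mu + 1)))).
    by rewrite !lt_min r20 r120 divr_gt0.
  move=> x s; rewrite !lt_min => /and3P[x2 _ _] /andP[s0 /and3P[_ s1 s2]].
  have : `|p x + s *: v x - p t| < r1.
    rewrite addrAC; apply: le_lt_trans (ler_normD _ _) _.
    rewrite normrZ (ger0_norm s0).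
    have := ler_wpM2l s0 (v1 x); have := hr2 _ x2; lra.
  move=> /hr1; rewrite ltr_norml => /andP[_ h1].
  move: s2; rewrite ltr_pdivlMr// => s2.
  lra.
have [d d0 hd] : Q 1.
  apply: interval_induction.
    have [|r r0 hr] := Qloc 0; first by rewrite lexx ler01.
    exists (r / 2); first by rewrite divr_gt0.
    move=> t s /le_anti<- /andP[s0 sr]; apply: hr; first by rewrite subrr normr0.
    by rewrite s0 /=; lra.
  move=> t t01; have [r r0 hr] := Qloc t t01; exists r => //.
  move=> s u /andP[s0 st] trs [d d0 hd] /andP[tu u1] utr.
  exists (Num.min d (r / 2)); first by rewrite lt_min d0 divr_gt0.
  move=> x z /andP[x0 xu] /andP[z0]; rewrite le_min => /andP[zd zr].
  have [xs|sx] := leP x s; first by apply: hd; [rewrite x0|rewrite z0].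
  apply: hr; last by apply/andP; split=> //; lra.
  by rewrite ltr_norml; apply/andP; split; lra.
have qa t : F (p t) = 0 -> p t + d *: v t = p t.
  by move=> /v0 ->; rewrite scaler0 addr0.
exists d => //; exists (fun t => p t + d *: v t); split.
- split.
  + move=> t; apply: cvgD; first exact: cp.
    by apply: cvgZ; [exact: cvg_cst|exact: cv].
  + by move=> t t0; rewrite qa pa.
  + by move=> t t1; rewrite qa pb.
- move=> t; rewrite addrC addKr normrZ gtr0_norm// ler_piMr// ltW//.
have dd : 0 <= d <= d by rewrite lexx ltW.
(* Outside the unit interval [F] is 0 on the new path; the bound needed there follows from the one
   at [t = 0], as [F] is nonnegative. *)
have end0 : 0 <= beta - mu * d.
  have := hd 0 d; rewrite lexx ler01 => /(_ isT dd).
  by apply: le_trans.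
move=> t; have [t0|t0] := leP t 0.
  by rewrite qa pa// -/F Fa.
have [t1|t1] := leP 1 t; first by rewrite qa pb// -/F Fb.
by apply: hd => //; rewrite !ltW.
Qed.

(* The Brezis-Browder ordering principle. *)
Lemma exists_maximal_of_bounded (R : realType) (T : Type) (le : T -> T -> Prop)
    (r : T -> R) (M : R) (x0 : T) :
  (forall x y z, le x y -> le y z -> le x z) ->
  (forall x y, le x y -> r x <= r y) ->
  (forall x, r x <= M) ->
  (forall s : nat -> T, (forall n, le (s n) (s n.+1)) ->
     exists l, forall n, le (s n) l) ->
  exists x, forall y, le x y -> r y <= r x.
Proof.
move=> trans mono bnd ub; apply: contrapT => nmax.
have ext x : exists2 y, le x y & r x < r y.
  apply: contrapT => h; apply: nmax; exists x => y xy.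
  by rewrite leNgt; apply/negP => xy'; apply: h; exists y.
(* Each step realises at least half of the gain still available. *)
have /choice[step hstep] x : exists y, le x y /\
    forall z, le x z -> r z - r x <= 2 * (r y - r x).
  pose S := [set r z | z in [set z | le x z]].
  have [y xy rxy] := ext x.
  have hS : has_sup S by split; [exists (r y), y|exists M => _ [z _ <-]].
  have Sle z : le x z -> r z <= sup S.
    by move=> xz; apply: ub_le_sup; [case: hS|exists z].
  have e0 : 0 < (sup S - r x) / 2.
    by rewrite divr_gt0// subr_gt0 (lt_le_trans rxy)// Sle.
  have [_ [z xz <-] hz] := sup_adherent e0 hS.
  by exists z; split=> // u /Sle; lra.
pose s n := iter n step x0.
have sS n : le (s n) (s n.+1) by have [] := hstep (s n).
have [l hl] := ub s sS; have [l' ll' rl] := ext l.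
(* The improvement [l'] on the upper bound [l] was available at every stage, so each step gained at
   least [g / 2], and [r] eventually exceeds [M]. *)
pose g := r l' - r l.
have sg n : r x0 + n%:R * (g / 2) <= r (s n).
  elim: n => [|n IH]; first by rewrite mul0r addr0.
  have [_ /(_ l' (trans _ _ _ (hl n) ll'))] := hstep (s n).
  have := mono _ _ (hl n).
  have -> : s n.+1 = step (s n) by [].
  have gE : g = r l' - r l by [].
  by rewrite -(natr1 n); lra.
have g0 : 0 < g / 2 by rewrite divr_gt0// subr_gt0.
pose N := (Num.truncn ((M - r x0) / (g / 2))).+1.
have := le_trans (sg N) (bnd _).
have : (M - r x0) / (g / 2) < N%:R by exact: truncnS_gt.
rewrite ltr_pdivrMr//; lra.
Qed.

(** The bound [sup (range r) - r n] does not depend on [t], so the convergence is uniform and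
    continuity passes to the limit. *)
Lemma limit_path (R : realType) (V : completeNormedModType R) (a b : V)
    (p : nat -> R -> V) (r : nat -> R) (M : R) :
  (forall n, path_between a b (p n)) ->
  (forall n m t, (n <= m)%N -> `|p m t - p n t| <= r m - r n) ->
  (forall n, r n <= M) ->
  exists2 q, path_between a b q &
    forall n t, `|q t - p n t| <= sup (range r) - r n.
Proof.
move=> pab pr rM; pose S := sup (range r).
have hS : has_sup (range r).
  by split; [exists (r 0%N), 0%N|exists M => _ [n _ <-]].
have /choice[q hq] t : exists l, forall n, `|l - p n t| <= S - r n.
  have [n m nm|//|l _ hl] := @cvg_dominated_increments R V (p^~ t) r M.
    exact: pr.
  by exists l.
have close e : 0 < e -> exists n, forall t, `|q t - p n t| < e.
  move=> e0; have [_ [n _ <-] hn] := sup_adherent e0 hS.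
  by exists n => t; apply: le_lt_trans (hq t n) _; rewrite -/S in hn; lra.
have qE t c : (forall n, p n t = c) -> q t = c.
  move=> pc; apply/eqP; rewrite -subr_eq0 -normr_le0.
  apply/ler_addgt0Pr => e e0; rewrite add0r.
  by have [n /(_ t)] := close e e0; rewrite pc => /ltW.
exists q => //; split.
- move=> t; apply/cvgrPdist_lt => e e0.
  have e3 : 0 < e / 3 by rewrite divr_gt0.
  have [n hn] := close _ e3; have [cp _ _] := pab n.
  have [d d0 hd] := continuous_eps (cp t) e3.
  apply/nbhs_ballP; exists d => //= s ts.
  have /hd h : `|s - t| < d by rewrite distrC.
  have -> : q t - q s = (q t - p n t) - (p n s - p n t) - (q s - p n s).
    by rewrite opprB addrA subrK opprB [RHS]addrA subrK.
  have := ler_normB ((q t - p n t) - (p n s - p n t)) (q s - p n s).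
  have := ler_normB (q t - p n t) (p n s - p n t).
  have := hn t; have := hn s; lra.
- by move=> t t0; apply: qE => n; have [_ pa _] := pab n; exact: pa.
- by move=> t t1; apply: qE => n; have [_ _ pb] := pab n; exact: pb.
Qed.

(** One [e] controls both the level and the weighted slope, so that [e = 1 / (n + 1)] produces the
    excluded sequence. *)
Lemma mountain_pass (R : realType) (X : completeNormedModType R)
    (Y : normedModType R) (f : X -> Y) (y : Y) (a b : X) (h phi : R -> R)
    (c e : R) (p0 : R -> X) (r0 : R) :
  C1 f -> f a = y -> f b = y ->
  (forall r, 0 <= r -> 0 <= h r) ->
  (forall r s, 0 <= r -> r <= s -> h r <= h s) ->
  (forall r s, 0 <= r -> r <= s -> phi r <= phi s) ->
  (forall r s, 0 <= r -> r <= s -> phi s - phi r <= (s - r) / (1 + h r)) ->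
  (forall M, exists2 r, 0 <= r & M < phi r) ->
  0 < c -> 0 < e ->
  (forall p l, path_between a b p -> (forall t, half_sqdist f y (p t) <= l) ->
     c <= l) ->
  path_between a b p0 -> (forall t, `|p0 t| <= r0) ->
  (forall t, half_sqdist f y (p0 t) <= c + e) ->
  exists x, c <= half_sqdist f y x <= c + e /\
    clarke_lambda (half_sqdist f y) x * (1 + h `|x|) < e.
Proof.
move=> Cf fa fb h0 hnd phind phiB phiU c0 e0 hc p0ab p0r p0c.
apply: contrapT => nx.
have hl x : c <= half_sqdist f y x <= c + e ->
    e <= clarke_lambda (half_sqdist f y) x * (1 + h `|x|).
  by move=> hx; rewrite leNgt; apply/negP => hx'; apply: nx; exists x.
pose F := half_sqdist f y.
have r00 : 0 <= r0 by apply: le_trans (p0r 0).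
(* Half of [e] makes [mu] below strictly smaller than [clarke_lambda]; [B] gives the pair [(p0, r0)]
   the allowed level [c + e]. *)
pose m := e / 2; have m0 : 0 < m by rewrite divr_gt0.
pose B := c + e + m * phi r0.
pose good (s : (R -> X) * R) := [/\ path_between a b s.1, r0 <= s.2,
  forall t, `|s.1 t| <= s.2 & forall t, F (s.1 t) <= B - m * phi s.2].
pose T := {s | good s}.
pose le (s s' : T) := (sval s).2 <= (sval s').2 /\
  forall t, `|(sval s').1 t - (sval s).1 t| <= (sval s').2 - (sval s).2.
have g0 : good (p0, r0).
  by split=> //= t; rewrite /B addrK; exact: p0c.
have [rM rM0 hrM] := phiU ((B - c) / m).
have bnd s : good s -> s.2 <= rM.
  move=> [s1 s2 s3 s4]; have cB := hc _ _ s1 s4.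
  rewrite leNgt; apply/negP => rs.
  have := ler_wpM2l (ltW m0) (phind _ _ rM0 (ltW rs)).
  by move: hrM; rewrite ltr_pdivrMr//; lra.
have [| | | |[[p r] ps] pmax] := @exists_maximal_of_bounded R T le (fun s => (sval s).2) rM
  (exist _ _ g0).
- move=> s1 s2 s3 [h1 h2] [h3 h4]; split; first exact: le_trans h1 h3.
  move=> t; rewrite -(subrKA ((sval s2).1 t)).
  by apply: le_trans (ler_normD _ _) _; have := h2 t; have := h4 t; lra.
- by move=> s s' [].
- by move=> [s gs]; exact: bnd.
- move=> s sle.
  pose p n := (sval (s n)).1; pose r n := (sval (s n)).2.
  have gs n : good (sval (s n)) := svalP (s n).
  have pr n k t : (n <= k)%N -> `|p k t - p n t| <= r k - r n.
    move=> /subnK <-; elim: (k - n)%N => [|i IH]; first by rewrite !subrr normr0.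
    rewrite -(subrKA (p (i + n)%N t)).
    apply: le_trans (ler_normD _ _) _.
    by have [_ /(_ t)] := sle (i + n)%N; rewrite -/(p _) -/(p _) -/(r _) -/(r _)
      -addSn; lra.
  have rM' n : r n <= rM by exact: bnd.
  have [|q qab hq] := @limit_path R X a b p r rM _ pr rM'.
    by move=> n; have [] := gs n.
  pose S := sup (range r).
  have hS : has_sup (range r).
    by split; [exists (r 0%N), 0%N|exists rM => _ [n _ <-]].
  have rS n : r n <= S by apply: ub_le_sup; [case: hS|exists n].
  have gq : good (q, S).
    split=> //=.
    + by apply: le_trans (rS 0%N); have [] := gs 0%N.
    + move=> t; have [_ _ /(_ t) h1 _] := gs 0%N.
      have := hq 0%N t; have := ler_normD (q t - p 0%N t) (p 0%N t).
      rewrite subrK -/S; rewrite -/(p 0%N) -/(r 0%N) in h1; lra.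
    (* As [1 + h >= 1], [phi] has slope at most 1: half of [d] goes to the change of [m * phi], half
       to the continuity of [F] at [q t]. *)
    + move=> t; apply/ler_addgt0Pr => d d0.
      have d20 : 0 < d / 2 by rewrite divr_gt0.
      have [x x0 hx] :=
        continuous_eps (@C1_half_sqdist_continuous _ _ _ f y Cf (q t)) d20.
      have dm0 : 0 < Num.min x (d / 2 / m) by rewrite lt_min x0 divr_gt0.
      have [_ [n _ <-]] := sup_adherent dm0 hS.
      rewrite -/S ltrBlDr -ltrBlDl lt_min ltr_pdivlMr// => /andP[h1 h2].
      have := hq n t; rewrite -/S distrC => /le_lt_trans/(_ h1)/hx.
      rewrite ltr_norml => /andP[h3 _].
      have [_ rn h4 /(_ t)] := gs n; rewrite -/(p n) -/(r n) => h5.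
      have rn0 : 0 <= r n by apply: le_trans r00 _.
      have h6 : phi S - phi (r n) <= S - r n.
        apply: le_trans (phiB _ _ rn0 (rS n)) _.
        have := h0 _ rn0 => hr; rewrite ler_pdivrMr; last by lra.
        by rewrite ler_peMr ?subr_ge0// lerDl.
      have := ler_wpM2l (ltW m0) h6.
      rewrite /F in h5 *; lra.
  exists (exist _ _ gq) => n; split=> /=; first exact: rS.
  by move=> t; exact: hq.
have [pab /= r0r pr pB] := ps.
have r'0 : 0 <= r by apply: le_trans r0r.
have h1r : 0 < 1 + h r by have := h0 _ r'0; lra.
pose beta := B - m * phi r.
have cbeta : c <= beta by apply: hc pB.
have betae : beta <= c + e.
  have := ler_wpM2l (ltW m0) (phind _ _ r00 r0r); rewrite /beta /B; lra.
(* [mu] bounds the slope of [m * phi] beyond [r]: enlarging the radius by [d] lowers the allowed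
   level by at most [mu * d], which the deformation gains. As [h |x| <= h r] on the path, [mu] is
   below [clarke_lambda] at its points of level [beta]. *)
pose mu := m / (1 + h r).
have mu0 : 0 < mu by rewrite divr_gt0.
have [|d d0 [q [qab qp qB]]] := @path_descent R X Y f y a b p beta mu Cf fa fb
    pab (lt_le_trans c0 cbeta) (ltW mu0) pB.
  move=> t Ft; apply: exists_descent_direction; [exact: (proj1 Cf)|exact: ltW|].
  have := hl (p t); rewrite Ft cbeta betae => /(_ isT) hle.
  have ph : 0 <= h `|p t| <= h r by rewrite h0// hnd.
  case/andP: ph => ph0 phr.
  rewrite ltr_pdivrMr//.
  apply: (@lt_le_trans _ _ e); first by rewrite /m; lra.
  apply: le_trans hle _.
  by rewrite ler_wpM2l ?clarke_lambda_ge0// lerD2l.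
have gq : good (q, r + d).
  split=> //=.
  - by apply: le_trans r0r _; rewrite lerDl ltW.
  - move=> t; have := ler_normD (q t - p t) (p t); rewrite subrK.
    have := qp t; have := pr t => /=; lra.
  - move=> t; apply: le_trans (qB t) _.
    have rd : r <= r + d by rewrite lerDl ltW.
    have := ler_wpM2l (ltW m0) (phiB _ _ r'0 rd).
    have -> : m * ((r + d - r) / (1 + h r)) = mu * d.
      by rewrite /mu (addrC r) addrK mulrCA mulrC.
    rewrite /beta; lra.
have := pmax (exist _ _ gq) => /=.
have rd : r + d <= r -> False by lra.
move=> H; apply: rd; apply: H; split=> /=; first by rewrite lerDl ltW.
by move=> t; rewrite (addrC r) addrK; exact: qp.
Qed.

(** * Bounds along paths and injectivity of [f] *)

Lemma path_bounded (R : realType) (V : normedModType R) (a b : V)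
    (p : R -> V) (g : V -> R) : path_between a b p -> continuous g ->
  exists M, forall t, g (p t) <= M.
Proof.
move=> [cp pa pb] cg.
have cgp : {within `[0, 1], continuous (g \o p)}.
  apply: continuous_subspaceT => t.
  by apply: continuous_comp; [exact: cp|exact: cg].
have [c _ hc] := EVT_max ler01 cgp.
exists (g (p c)) => t.
have [t0|t0] := leP t 0.
  by rewrite (pa t)// -(pa 0)//; apply: hc; rewrite in_itv/= lexx ler01.
have [t1|t1] := leP 1 t.
  by rewrite (pb t)// -(pb 1)//; apply: hc; rewrite in_itv/= lexx ler01.
by apply: hc; rewrite in_itv/= !ltW.
Qed.

Lemma segment_path (R : realType) (V : normedModType R) (a b : V) :
  path_between a b (fun t => a + Num.max 0 (Num.min 1 t) *: (b - a)).
Proof.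
have cclamp : continuous (fun t : R => Num.max 0 (Num.min 1 t)).
  move=> t; apply: (@continuous_max R R (cst 0) (fun t => Num.min 1 t) t).
    exact: cvg_cst.
  by apply: (@continuous_min R R (cst 1) id t); [exact: cvg_cst|exact: cvg_id].
split=> [t|t t0|t t1].
- apply: cvgD; first exact: cvg_cst.
  by apply: cvgZ; [exact: cclamp|exact: cvg_cst].
- have -> : Num.max 0 (Num.min 1 t) = 0.
    by apply/max_idPl; rewrite ge_min t0 orbT.
  by rewrite scale0r addr0.
- have -> : Num.min 1 t = 1 by exact/min_idPl.
  by have -> : Num.max 0 1 = 1 :> R; [exact/max_idPr|rewrite scale1r addrC subrK].
Qed.

Unset Implicit Arguments.

Theorem theorem8 (R : realType) (X Y : completeNormedModType R)
  (f : X -> Y) (f_diffeo : local_C1_diffeo f)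
  (h : R -> R)
  (h_ge0 : forall rho, 0 <= rho -> 0 <= h rho)
  (h_cont : {within `[0, +oo[, continuous h})
  (h_ndec : forall r s, 0 <= r -> r <= s -> h r <= h s)
  (h_int : (\int[@lebesgue_measure R]_(rho in `[0%R, +oo[)
              ((1 + h rho)^-1)%:E)%E = +oo%E)
  (no_seq : forall y : Y,
     ~ exists x_ : nat -> X,
         (exists c : R,
            0 < c /\ half_sqdist f y (x_ n) @[n --> \oo] --> c) /\
         clarke_lambda (half_sqdist f y) (x_ n) * (1 + h `|x_ n|)
           @[n --> \oo] --> (0 : R)) :
  injective f.
Proof.
move=> a b fab; apply: contrapT => ab.
have [Cf fbij] := f_diffeo.
pose y := f b; pose F := half_sqdist f y.
have cF : continuous F by exact: C1_half_sqdist_continuous.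
have nab : 0 < `|b - a|.
  by rewrite normr_gt0 subr_eq0; apply/eqP => ba; apply: ab.
have [phi [phind phiB phiU]] := weight_primitive h_ge0 h_cont h_ndec h_int.
pose L := [set l | exists2 p, path_between a b p & forall t, F (p t) <= l].
have L0 : L !=set0.
  have [M hM] := path_bounded (segment_path a b) cF.
  by exists M; eexists; [exact: segment_path|exact: hM].
have [c c0 Lc] : exists2 c, 0 < c & lbound L c.
  have [k k0 [r r0 hr]] := C1_isolated_preimage Cf (fbij a).
  (* [s <= |b - a|] makes every path cross the sphere of radius [s] about [a], and [s < r] gives the
     lower bound [k * s] for [|f - f a|] at the crossing. *)
  pose s := Num.min (r / 2) `|b - a|.
  have s0 : 0 < s by rewrite lt_min divr_gt0.
  exists (2^-1 * (k * s) ^+ 2).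
    by rewrite mulr_gt0 ?invr_gt0// exprn_gt0// mulr_gt0.
  move=> l [p [cp pa pb] pl].
  have cpa : {within `[0, 1], continuous (fun t => `|p t - a|)}.
    apply: continuous_subspaceT => t; apply: cvg_norm.
    by apply: cvgB; [exact: cp|exact: cvg_cst].
  have [|t _ ht] := IVT (v := s) ler01 cpa.
    rewrite /= pa// pb// subrr normr0 ge_min le_max (ltW s0)/=.
    by rewrite /s !ge_min lexx !orbT.
  apply: le_trans (pl t).
  have sr : s < r by rewrite gt_min; apply/orP; left; lra.
  have := hr (p t); rewrite ht => /(_ sr) h1.
  rewrite /F /half_sqdist ler_pM2l ?invr_gt0//.
  have ks0 : 0 <= k * s by rewrite mulr_ge0 // ltW.
  by rewrite lerXn2r ?nnegrE // /y -fab.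
have hL : has_inf L by split=> //; exists c.
have c'0 : 0 < inf L by apply: lt_le_trans c0 _; exact: lb_le_inf.
have Linf p l : path_between a b p -> (forall t, F (p t) <= l) -> inf L <= l.
  by move=> pab pl; apply: ge_inf; [case: hL|exists p].
apply: (no_seq y).
have /choice[x_ hx] n : exists x,
    inf L <= F x <= inf L + n.+1%:R^-1 /\
    clarke_lambda F x * (1 + h `|x|) < n.+1%:R^-1.
  have n0 : 0 < n.+1%:R^-1 :> R by rewrite invr_gt0.
  have [l [p pab pl] hl] := inf_adherent n0 hL.
  have [r hr] := path_bounded pab (@norm_continuous _ X).
  have [x [hx1 hx2]] := mountain_pass Cf fab erefl h_ge0 h_ndec phind phiB
    phiU c'0 n0 Linf pab hr (fun t => le_trans (pl t) (ltW hl)).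
  by exists x.
have inv0 : (n.+1%:R^-1 : R) @[n --> \oo] --> (0 : R) by exact: cvg_harmonic.
exists x_; split.
  exists (inf L); split=> //.
  apply: (@squeeze_cvgr _ _ _ _ (cst (inf L)) (fun n => inf L + n.+1%:R^-1)).
  - by apply: nearW => n; have [] := hx n.
  - exact: cvg_cst.
  - rewrite -[X in _ --> X]addr0; apply: cvgD => //; exact: cvg_cst.
apply: (@squeeze_cvgr _ _ _ _ (cst 0) (fun n => n.+1%:R^-1)) => //.
  apply: nearW => n; have [_ /ltW ->] := hx n; rewrite andbT.
  by rewrite mulr_ge0 ?clarke_lambda_ge0// addr_ge0// h_ge0.
exact: cvg_cst.
Qed.
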